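(* Let $k_3,k_5>0$ and $k>k_3+k_5$, and consider on $\mathbb{R}^3_+=\{(x,y,z):x,y,z\ge 0\}$ the system $$x'=kx-xy,\qquad y'=k_3(z-y),\qquad z'=k_5(x-z),$$ with equilibrium $E=(k,k,k)$. Then the stable manifold of $E$ in $\mathbb{R}^3_+$ consists of $E$ and (the trajectories of) two monotone solutions $p_u(t)=(x_u(t),y_u(t),z_u(t))$, $t\in[0,\infty)$, and $p_l(t)=(x_l(t),y_l(t),z_l(t))$, $t\in[0,\infty)$, with the following properties. The solution $p_u$ satisfies $p_u(0)=(x_u(0),0,z_u(0))$ with $0<x_u(0)<k<z_u(0)$, $p_u(\infty)=E$, and $x_u,y_u$ are strictly increasing while $z_u$ is strictly decreasing. Therefore, the graph of $p_u$ belongs to $[0,k]\times[0,k]\times[k,\infty)$. The solution $p_l$ satisfies $p_l(0)=(x_l(0),y_l(0),0)$ with $x_l(0),y_l(0)>k$, $p_l(\infty)=E$, and $x_l,y_l$ are strictly decreasing while $z_l$ is strictly increasing. Therefore, the graph of $p_l$ belongs to $[k,\infty)\times[k,\infty)\times[0,k]$.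
   Context: The stable manifold of $E$ in $\mathbb{R}^3_+$ is the set of points of $\mathbb{R}^3_+$ whose forward solutions converge to $E$ as $t\to\infty$ (when $k>k_3+k_5$, $E$ is hyperbolic with one negative eigenvalue and a pair of complex conjugate eigenvalues with positive real part). The notation $p(\infty)=E$ means $\lim_{t\to\infty}p(t)=E$. The ''graph'' of a solution $p$ means its trajectory $\{p(t):t\ge 0\}\subset\mathbb{R}^3_+$. *)

(* Defs.v *)
From Stdlib Require Import Reals.
From Coquelicot Require Import Coquelicot.
Open Scope R_scope.

Definition R3 : Type := (R * R * R)%type.

Definition orthant (P : R3) : Prop :=
  let '(x, y, z) := P in 0 <= x /\ 0 <= y /\ 0 <= z.

Definition equilibrium (k : R) : R3 := (k, k, k).

Definition halfline (t : R) : Prop := 0 <= t.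

(* A forward solution is a function on [0, oo); being total, [x], [y], [z] also
   have values at negative times, which are unconstrained.  The derivative
   [D_in] is taken relative to [0, oo), so it is one-sided at time 0. *)
Definition forward_solution (k k3 k5 : R) (x y z : R -> R) : Prop :=
  forall t, 0 <= t ->
    orthant (x t, y t, z t) /\
    D_in x (fun s => k * x s - x s * y s) halfline t /\
    D_in y (fun s => k3 * (z s - y s)) halfline t /\
    D_in z (fun s => k5 * (x s - z s)) halfline t.

Definition tends_to (x y z : R -> R) (P : R3) : Prop :=
  filterlim (fun t => (x t, y t, z t)) (Rbar_locally p_infty) (locally P).

(* The vector field is locally Lipschitz, so the forward solution from a given
   point is unique and "some" may be read as "the". *)
Definition stable_manifold (k k3 k5 : R) (P : R3) : Prop :=
  orthant P /\
  exists x y z : R -> R,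
    forward_solution k k3 k5 x y z /\
    (x 0, y 0, z 0) = P /\
    tends_to x y z (equilibrium k).

Definition trajectory (x y z : R -> R) (P : R3) : Prop :=
  exists t, 0 <= t /\ P = (x t, y t, z t).

Definition strictly_increasing_on (D : R -> Prop) (f : R -> R) : Prop :=
  forall s t, D s -> D t -> s < t -> f s < f t.

Definition strictly_decreasing_on (D : R -> Prop) (f : R -> R) : Prop :=
  forall s t, D s -> D t -> s < t -> f t < f s.

(* Main.v *)
Require Import Defs.
From Stdlib Require Import Reals Lra Psatz Lia Classical FunctionalExtensionality.
From Coquelicot Require Import Coquelicot.
Open Scope R_scope.

(** In the coordinates [a = ln (x / k)], [b = y - k], [c = k - z] the system reads
    [a' = - b], [b' = - k3 (b + c)], [c' = - k5 (c + k (exp a - 1))], with the equilibrium at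
    the origin.  Backwards in time it is cooperative: each variable is driven by a positive
    amount of the next one.  The same holds for the difference of two solutions, where
    [k (exp a - 1)] becomes [m a] with [m] a mean value of the two [x], so that [m] tends to
    [k] when both solutions tend to [E].  Everything follows from two facts.

    Rigidity.  If such a difference tends to 0 as [t] tends to infinity, then its three
    components are all positive, all negative or all zero, for every [t >= 0]
    ([vanishing_solution_signed], [stable_solutions_ordered]).  At [E] the linear part has one
    eigenvalue [- lam < 0], with a positive eigenvector, and it expands on the quotient by that
    eigenvector, which is where [k > k3 + k5] enters.  A quadratic form that is nondecreasing
    along solutions therefore confines a vanishing difference to a thin cone around the
    eigenvector from some time on ([eventually_signed]), and the positive and negative cones are
    backward invariant ([cone_backward_invariant]).  Comparing a solution in the stable manifold
    with [E] itself shows that it stays on one side of [E] in all three coordinates; comparing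
    two solutions on the same side, after a time shift that makes one coordinate agree, shows
    that they lie on one orbit.

    Existence.  In reversed time [s = - t] an orbit leaving the origin inside the positive cone
    is a fixed point [a = cascade (G o a)] of a positive integral operator on functions that
    decay like [exp (lam s)] at minus infinity.  The linear problem has the solution
    [exp (lam s)], and a contraction in a weighted distance of higher order at minus infinity
    produces a nonlinear solution close to it ([weighted_fixed_point],
    [unstable_orbit_exists]).  The two branches are [G a = k (1 - exp (- a))], for the solution
    with [x < k], and [G a = k (exp a - 1)], for the one with [x > k].  The components grow
    exponentially in [s], so that [y], respectively [z], reaches 0 at some [s = S]; restarting
    time there and reversing it gives [p_u], respectively [p_l]. *)

(** * Monotonicity from derivatives *)

Ltac subst_derive H :=
  match type of H with
  | is_derive ?f ?x ?l =>
      replace (Derive (fun y : R => f y) x) with l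
        by (symmetry; exact (is_derive_unique _ _ _ H))
  end.

Lemma le_of_derive_nonneg (f df : R -> R) (s t : R) :
  s <= t ->
  (forall u, s < u < t -> is_derive f u (df u)) ->
  (forall u, s <= u <= t -> continuous f u) ->
  (forall u, s <= u <= t -> 0 <= df u) ->
  f s <= f t.
Proof.
  intros Hst Hd Hc Hp.
  destruct (MVT_gen f s t df) as [u [Hu He]];
    rewrite ?(Rmin_left s t), ?(Rmax_right s t) in * by lra.
  - exact Hd.
  - intros u Hu; apply continuity_pt_filterlim, Hc, Hu.
  - specialize (Hp u Hu); nra.
Qed.

Lemma lt_of_derive_pos (f df : R -> R) (s t : R) :
  s < t ->
  (forall u, s < u < t -> is_derive f u (df u)) ->
  (forall u, s <= u <= t -> continuous f u) ->
  (forall u, s <= u <= t -> 0 < df u) ->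
  f s < f t.
Proof.
  intros Hst Hd Hc Hp.
  destruct (MVT_gen f s t df) as [u [Hu He]];
    rewrite ?(Rmin_left s t), ?(Rmax_right s t) in * by lra.
  - exact Hd.
  - intros u Hu; apply continuity_pt_filterlim, Hc, Hu.
  - specialize (Hp u Hu); nra.
Qed.

Lemma derive_continuous (f : R -> R) (s l : R) : is_derive f s l -> continuous f s.
Proof. intros Hd; apply (ex_derive_continuous f); exists l; exact Hd. Qed.

Lemma exp_monotone (x y : R) : x <= y -> exp x <= exp y.
Proof.
  intros [H | ->]; [apply Rlt_le, exp_increasing, H | apply Rle_refl].
Qed.

(** Gronwall's inequality in the form of a lower bound: [f * exp (- kap * u)] is
    nondecreasing. *)
Lemma gronwall_lower (kap : R) (f df : R -> R) (s t : R) :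
  s <= t ->
  (forall u, s < u < t -> is_derive f u (df u)) ->
  (forall u, s <= u <= t -> continuous f u) ->
  (forall u, s <= u <= t -> kap * f u <= df u) ->
  f s * exp (kap * (t - s)) <= f t.
Proof.
  intros Hst Hd Hc Hle.
  assert (Hmono : f s * exp (- (kap * s)) <= f t * exp (- (kap * t))).
  { apply (le_of_derive_nonneg (fun u => f u * exp (- (kap * u)))
             (fun u => (df u - kap * f u) * exp (- (kap * u)))); [assumption | | |].
    - intros u Hu; pose proof (Hd u Hu) as du; auto_derive; [eexists; exact du |].
      subst_derive du; ring.
    - intros u Hu; pose proof (Hc u Hu) as Cu.
      apply continuity_pt_filterlim; apply continuity_pt_filterlim in Cu; reg; assumption.
    - intros u Hu; specialize (Hle u Hu).
      apply Rmult_le_pos; [lra | apply Rlt_le, exp_pos]. }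
  replace (- (kap * s)) with (kap * (t - s) + - (kap * t)) in Hmono by ring.
  rewrite exp_plus, <- Rmult_assoc in Hmono.
  apply Rmult_le_reg_r in Hmono; [exact Hmono | apply exp_pos].
Qed.

(** Downward real induction on [[0, T]]: at the supremum of the failures [P] would hold, as it
    holds to the right of it, and then there would be no failures just to the left either. *)
Lemma backward_induction (P : R -> Prop) (T : R) :
  P T ->
  (forall t, 0 <= t < T -> (forall s, t < s <= T -> P s) -> P t) ->
  (forall t, 0 < t <= T -> P t -> exists e, 0 < e /\ forall s, t - e < s <= t -> P s) ->
  forall t, 0 <= t <= T -> P t.
Proof.
  intros HT Hclosed Hopen t0 Ht0.
  apply NNPP; intros Hn.
  destruct (completeness (fun s => 0 <= s <= T /\ ~ P s)) as [tau [Hub Hlub]].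
  - exists T; intros s [Hs _]; lra.
  - exists t0; split; assumption.
  - assert (Htau : t0 <= tau) by (apply Hub; split; assumption).
    assert (HtauT : tau <= T) by (apply Hlub; intros s [Hs _]; lra).
    assert (Hafter : forall s, tau < s <= T -> P s).
    { intros s Hs; apply NNPP; intros Hns.
      assert (s <= tau) by (apply Hub; split; [lra | assumption]); lra. }
    assert (HPtau : P tau).
    { destruct (Req_dec tau T) as [-> | Hne]; [exact HT |].
      apply Hclosed; [lra | exact Hafter]. }
    destruct (Req_dec tau 0) as [H0 | H0].
    + apply Hn; replace t0 with tau by lra; exact HPtau.
    + destruct (Hopen tau) as [e [He Hbefore]]; [lra | exact HPtau |].
      assert (tau <= tau - e); [| lra].
      apply Hlub; intros s [Hs Hns].
      destruct (Rle_lt_dec s (tau - e)); [assumption |].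
      exfalso; apply Hns, Hbefore; split; [lra |].
      apply Hub; split; assumption.
Qed.

(** * A cooperative linear system, run backwards *)

(** The difference of two solutions in the coordinates above.  The derivatives are required only
    for [t > 0] since solutions start at time 0. *)
Definition cone_system (k3 k5 : R) (m a b c : R -> R) : Prop :=
  (forall t, continuous a t /\ continuous b t /\ continuous c t) /\
  (forall t, 0 < t ->
     is_derive a t (- b t) /\
     is_derive b t (- (k3 * (b t + c t))) /\
     is_derive c t (- (k5 * (c t + m t * a t)))).

Definition positive_at (a b c : R -> R) (t : R) : Prop :=
  0 < a t /\ 0 < b t /\ 0 < c t.

Lemma continuous_pos_near (f : R -> R) (t : R) :
  continuous f t -> 0 < f t ->
  exists e, 0 < e /\ forall s, Rabs (s - t) < e -> 0 < f s.
Proof.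
  intros Hc Hp.
  destruct (proj1 (filterlim_locally f (f t)) Hc (mkposreal _ Hp)) as [e He].
  exists e; split; [apply cond_pos |].
  intros s Hs; specialize (He s Hs).
  unfold ball in He; simpl in He; unfold AbsRing_ball, abs, minus, plus, opp in He; simpl in He.
  apply Rabs_lt_between in He; lra.
Qed.

(** The sign of [df] is used only to the right of [s]: this is the step that carries strict
    positivity down to the left end of an interval on which it is known. *)
Lemma le_at_left_end (f df : R -> R) (s t : R) :
  s < t ->
  (forall u, s < u < t -> is_derive f u (df u)) ->
  (forall u, s <= u <= t -> continuous f u) ->
  (forall u, s < u <= t -> df u <= 0) ->
  f t <= f s.
Proof.
  intros Hst Hd Hc Hp.
  destruct (Rle_lt_dec (f t) (f s)) as [|Hlt]; [assumption |].
  destruct (continuous_pos_near (fun u => f t - f u) s) as [e [He Hn]].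
  - apply (continuous_minus (fun _ => f t) f); [apply continuous_const | apply Hc; lra].
  - lra.
  - set (u := Rmin (s + e / 2) t).
    assert (Hu : s < u <= t /\ u < s + e).
    { unfold u; split; [split |].
      - apply Rmin_glb_lt; lra.
      - apply Rmin_r.
      - pose proof (Rmin_l (s + e/2) t); lra. }
    assert (0 < f t - f u) by (apply Hn; rewrite Rabs_pos_eq; lra).
    assert (- f u <= - f t); [| lra].
    apply (le_of_derive_nonneg (fun v => - f v) (fun v => - df v)); try lra.
    + intros v Hv; apply (is_derive_opp f), Hd; lra.
    + intros v Hv; apply (continuous_opp f), Hc; lra.
    + intros v Hv; specialize (Hp v); lra.
Qed.

(** As long as all three components are positive they decrease in time, so that going backwards
    they cannot reach 0. *)
Lemma cone_backward_invariant (k3 k5 : R) (m a b c : R -> R) (T : R) :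
  0 < k3 -> 0 < k5 -> (forall t, 0 <= t -> 0 < m t) ->
  cone_system k3 k5 m a b c ->
  positive_at a b c T ->
  forall t, 0 <= t <= T -> positive_at a b c t.
Proof.
  intros H3 H5 Hm [Hc Hd] HT.
  apply backward_induction; [exact HT | |].
  - intros t Ht Hafter.
    destruct HT as [HaT [HbT HcT]].
    repeat split.
    + apply Rlt_le_trans with (a T); [assumption |].
      apply (le_at_left_end a (fun u => - b u)); try lra.
      * intros u Hu; apply Hd; lra.
      * intros u Hu; apply Hc.
      * intros u Hu; destruct (Hafter u Hu) as [_ [? _]]; lra.
    + apply Rlt_le_trans with (b T); [assumption |].
      apply (le_at_left_end b (fun u => - (k3 * (b u + c u)))); try lra.
      * intros u Hu; apply Hd; lra.
      * intros u Hu; apply Hc.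
      * intros u Hu; destruct (Hafter u Hu) as [_ [? ?]]; nra.
    + apply Rlt_le_trans with (c T); [assumption |].
      apply (le_at_left_end c (fun u => - (k5 * (c u + m u * a u)))); try lra.
      * intros u Hu; apply Hd; lra.
      * intros u Hu; apply Hc.
      * intros u Hu; destruct (Hafter u Hu) as [? [? ?]].
        assert (0 < m u) by (apply Hm; lra).
        assert (0 < m u * a u) by (apply Rmult_lt_0_compat; lra).
        nra.
  - intros t Ht [Ha [Hb Hcc]].
    destruct (Hc t) as [Ca [Cb Cc]].
    destruct (continuous_pos_near a t Ca Ha) as [e1 [He1 H1]].
    destruct (continuous_pos_near b t Cb Hb) as [e2 [He2 H2]].
    destruct (continuous_pos_near c t Cc Hcc) as [e3 [He3 H3']].
    exists (Rmin e1 (Rmin e2 e3)); split.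
    + repeat apply Rmin_glb_lt; assumption.
    + intros s Hs.
      pose proof (Rmin_l e1 (Rmin e2 e3)); pose proof (Rmin_r e1 (Rmin e2 e3)).
      pose proof (Rmin_l e2 e3); pose proof (Rmin_r e2 e3).
      assert (Rabs (s - t) < Rmin e1 (Rmin e2 e3)) by (rewrite Rabs_left1; lra).
      repeat split; [apply H1 | apply H2 | apply H3']; lra.
Qed.

(** Backward uniqueness: the squared norm [E] satisfies [E' >= - K E]. *)
Lemma zero_backward (k3 k5 : R) (m a b c : R -> R) (T M : R) :
  0 < k3 -> 0 < k5 ->
  (forall t, 0 <= t <= T -> 0 < m t <= M) ->
  cone_system k3 k5 m a b c ->
  a T = 0 -> b T = 0 -> c T = 0 ->
  forall t, 0 <= t <= T -> a t = 0 /\ b t = 0 /\ c t = 0.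
Proof.
  intros H3 H5 Hm [Hc Hd] HaT HbT HcT t Ht.
  set (E := fun u => a u ^ 2 + b u ^ 2 + c u ^ 2).
  set (K := 1 + 3 * k3 + 2 * k5 + k5 * M).
  set (dE := fun u => - 2 * a u * b u - 2 * k3 * b u * (b u + c u)
                      - 2 * k5 * c u * (c u + m u * a u)).
  assert (HM : 0 < M) by (specialize (Hm t Ht); lra).
  assert (HE : E t * exp (- K * (T - t)) <= E T).
  { apply (gronwall_lower (- K) E dE); try lra.
    - intros u Hu.
      destruct (Hd u) as [da [db dc]]; [lra |].
      unfold E, dE; auto_derive.
      + repeat split; eexists; eassumption.
      + subst_derive da; subst_derive db; subst_derive dc; ring.
    - intros u Hu.
      destruct (Hc u) as [Ca [Cb Cc]].
      apply continuity_pt_filterlim.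
      apply continuity_pt_filterlim in Ca, Cb, Cc.
      unfold E; reg; assumption.
    - intros u Hu.
      specialize (Hm u ltac:(lra)).
      cut (0 <= dE u + K * E u); [lra |].
      unfold dE, E, K.
      generalize (a u) (b u) (c u); intros x y z; clear - Hm H3 H5 HM.
      generalize dependent (m u); intros mu Hm.
      pose proof (pow2_ge_0 x); pose proof (pow2_ge_0 y); pose proof (pow2_ge_0 z).
      pose proof (pow2_ge_0 (x - y)); pose proof (pow2_ge_0 (y - z));
        pose proof (pow2_ge_0 (x - z)).
      assert (0 <= k3 * (y - z) ^ 2) by (apply Rmult_le_pos; lra).
      assert (0 <= k3 * x ^ 2) by (apply Rmult_le_pos; lra).
      assert (0 <= k3 * z ^ 2) by (apply Rmult_le_pos; lra).
      assert (0 <= k3 * y ^ 2) by (apply Rmult_le_pos; lra).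
      assert (0 <= k5 * y ^ 2) by (apply Rmult_le_pos; lra).
      assert (0 <= k5 * x ^ 2) by (apply Rmult_le_pos; lra).
      assert (0 <= k5 * (M * y ^ 2)) by (apply Rmult_le_pos; [lra | apply Rmult_le_pos; lra]).
      assert (0 <= k5 * ((M - mu) * (x ^ 2 + z ^ 2))) by (apply Rmult_le_pos; [lra | apply Rmult_le_pos; lra]).
      assert (0 <= k5 * (mu * (x - z) ^ 2)) by (apply Rmult_le_pos; [lra | apply Rmult_le_pos; lra]).
      lra. }
  assert (HET : E T = 0) by (unfold E; rewrite HaT, HbT, HcT; ring).
  rewrite HET in HE.
  pose proof (exp_pos (- K * (T - t))).
  assert (E t <= 0) by nra.
  unfold E in *.
  pose proof (pow2_ge_0 (a t)); pose proof (pow2_ge_0 (b t)); pose proof (pow2_ge_0 (c t)).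
  repeat split; nra.
Qed.

(** * Solutions tending to zero lie in the cone *)

(** [- lam] is the stable eigenvalue of the linearization at the equilibrium.  The condition
    [k > k3 + k5] is exactly what makes [lam > k3 + k5]; the trace of the linearization is
    [- (k3 + k5)], so that the other two eigenvalues have positive sum. *)
Definition dominant_rate (k k3 k5 lam : R) : Prop :=
  k3 + k5 < lam /\ lam * (lam - k3) * (lam - k5) = k3 * k5 * k.

Lemma dominant_rate_exists (k k3 k5 : R) :
  0 < k3 -> 0 < k5 -> k3 + k5 < k -> exists lam, dominant_rate k k3 k5 lam.
Proof.
  intros H3 H5 Hk.
  set (f := fun l => l * (l - k3) * (l - k5) - k3 * k5 * k).
  assert (H35 : 0 < k3 * k5) by (apply Rmult_lt_0_compat; assumption).
  assert (Hf0 : f (k3 + k5) < 0) by (unfold f; nra).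
  assert (Hf1 : 0 < f (k3 + k5 + k)).
  { unfold f.
    replace (k3 + k5 + k - k3) with (k5 + k) by ring.
    replace (k3 + k5 + k - k5) with (k3 + k) by ring.
    assert (0 < k3 * k) by nra. assert (0 < k5 * k) by nra. assert (0 < k * k) by nra.
    assert (0 < k3 * k5 * k) by nra.
    assert (0 < (k3 + k5 + k) * (k * k)) by nra.
    assert (0 < (k3 + k5 + k) * (k3 * k)) by nra.
    assert (0 < (k3 + k5 + k) * (k5 * k)) by nra.
    assert (0 < (k3 + k5) * (k3 * k5)) by nra.
    nra. }
  destruct (IVT f (k3 + k5) (k3 + k5 + k)) as [l [Hl Hz]].
  - unfold f; reg.
  - lra.
  - exact Hf0.
  - exact Hf1.
  - exists l; unfold f in Hz, Hf0; split; [| lra].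
    destruct (Req_dec l (k3 + k5)) as [-> | ?]; lra.
Qed.

(** With [r = lam (lam - k3) / k3], the vector [(1, lam, r)] spans the stable direction and
    [p = b - lam a], [q = c - r a] are coordinates on the quotient.  There the linearization acts
    by [p' = (lam - k3) p - k3 q], [q' = r p - k5 q], and the form below is [p q' - q p']: being the
    determinant of a vector and its velocity, it satisfies exactly
    [expanding_form' = (lam - k3 - k5) * expanding_form]. *)
Definition expanding_form (k3 k5 lam p q : R) : R :=
  lam * (lam - k3) / k3 * p ^ 2 - (k5 + (lam - k3)) * p * q + k3 * q ^ 2.

(** Definiteness means that the eigenvalues on the quotient are not real.  In terms of
    [tau = lam - k3 - k5] the discriminant is a sum of positive terms. *)
Lemma form_definite (k3 k5 lam : R) :
  0 < k3 -> 0 < k5 -> k3 + k5 < lam ->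
  exists nu, 0 < nu /\ forall p q, nu * (p ^ 2 + q ^ 2) <= expanding_form k3 k5 lam p q.
Proof.
  intros H3 H5 Hlam.
  set (r := lam * (lam - k3) / k3).
  set (be := k5 + (lam - k3)).
  assert (Hr : 0 < r) by (unfold r; apply Rdiv_lt_0_compat; nra).
  assert (Hrk : r * k3 = lam * (lam - k3)) by (unfold r; field; lra).
  assert (Hdisc : 0 < 4 * (r * k3) - be ^ 2).
  { rewrite Hrk; unfold be.
    replace lam with ((lam - k3 - k5) + (k3 + k5)) by ring.
    assert (0 < lam - k3 - k5) by lra.
    generalize dependent (lam - k3 - k5); intros tau Ht.
    assert (0 < tau * k3) by nra. assert (0 < tau * k5) by nra.
    assert (0 < k3 * k5) by nra. nra. }
  (* the smaller eigenvalue of the form is at least its determinant over its trace *)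
  set (nu := (4 * (r * k3) - be ^ 2) / (4 * (r + k3))).
  assert (Hnu : nu * (r + k3) = (4 * (r * k3) - be ^ 2) / 4) by (unfold nu; field; lra).
  assert (Hnu0 : 0 < nu) by (unfold nu; apply Rdiv_lt_0_compat; lra).
  exists nu; split; [exact Hnu0 |]; intros p q.
  assert (Hrnu : 0 < r - nu).
  { assert (0 < (r - nu) * (r + k3)); [| nra].
    pose proof (pow2_ge_0 be). pose proof (pow2_ge_0 r). nra. }
  unfold expanding_form; fold r; fold be.
  assert (Hsq : (r - nu) * (r * p ^ 2 - be * p * q + k3 * q ^ 2 - nu * (p ^ 2 + q ^ 2))
            = ((r - nu) * p - be / 2 * q) ^ 2 + (nu ^ 2) * q ^ 2).
  { replace (nu ^ 2) with (r * k3 - nu * (r + k3) + nu ^ 2 - be ^ 2 / 4) by (rewrite Hnu; field).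
    field. }
  assert (0 <= (r - nu) * (r * p ^ 2 - be * p * q + k3 * q ^ 2 - nu * (p ^ 2 + q ^ 2))).
  { rewrite Hsq.
    pose proof (pow2_ge_0 ((r - nu) * p - be / 2 * q)).
    pose proof (Rmult_le_pos _ _ (pow2_ge_0 nu) (pow2_ge_0 q)). lra. }
  apply Rnot_lt_le; intros Hlt. nra.
Qed.

(** The expression in the first claim is the derivative of [expanding_form - delta a ^ 2]
    along the system when the coefficient [m] is [k - e]: the expansion of the form and of [- a ^ 2]
    absorb the cross terms when [delta] and [eps] are small.  The second claim says that the
    region where [expanding_form <= delta a ^ 2] is so thin around the line spanned by [(1, lam, r)]
    that all coordinates have the sign of [a] there. *)
Lemma cone_form (k3 k5 lam : R) :
  0 < k3 -> 0 < k5 -> k3 + k5 < lam ->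
  exists delta eps, 0 < delta /\ 0 < eps /\
    (forall a p q e, Rabs e <= eps ->
       0 <= (lam - k3 - k5) * expanding_form k3 k5 lam p q
            + k5 * e * a * (2 * k3 * q - (k5 + (lam - k3)) * p)
            + 2 * delta * a * (lam * a + p)) /\
    (forall a p q, expanding_form k3 k5 lam p q <= delta * a ^ 2 ->
       a = 0 /\ p = 0 /\ q = 0 \/
       Rabs p < lam * Rabs a /\ Rabs q < lam * (lam - k3) / k3 * Rabs a).
Proof.
  intros H3 H5 Hlam.
  destruct (form_definite k3 k5 lam H3 H5 Hlam) as [nu [Hnu Hform]].
  set (r := lam * (lam - k3) / k3).
  assert (Hr : 0 < r) by (unfold r; apply Rdiv_lt_0_compat; nra).
  assert (Hlam0 : 0 < lam) by lra.
  set (sg := (lam - k3 - k5) * nu).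
  assert (Hsg : 0 < sg) by (unfold sg; apply Rmult_lt_0_compat; lra).
  assert (Hlnu : 0 < nu * lam ^ 2 / 2).
  { apply Rdiv_lt_0_compat; [apply Rmult_lt_0_compat; [|apply pow_lt]|]; lra. }
  assert (Hrnu : 0 < nu * r ^ 2 / 2).
  { apply Rdiv_lt_0_compat; [apply Rmult_lt_0_compat; [|apply pow_lt]|]; lra. }
  assert (Hsl : 0 < sg * lam / 2).
  { apply Rdiv_lt_0_compat; [apply Rmult_lt_0_compat|]; lra. }
  set (de := Rmin (sg * lam / 2) (Rmin (nu * lam ^ 2 / 2) (nu * r ^ 2 / 2))).
  assert (Hde : 0 < de) by (unfold de; repeat apply Rmin_glb_lt; assumption).
  assert (Hde1 : de <= sg * lam / 2) by apply Rmin_l.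
  assert (Hde2 : de <= nu * lam ^ 2 / 2).
  { eapply Rle_trans; [apply Rmin_r | apply Rmin_l]. }
  assert (Hde3 : de <= nu * r ^ 2 / 2).
  { eapply Rle_trans; [apply Rmin_r | apply Rmin_r]. }
  set (M := k5 * (2 * k3 + (k5 + (lam - k3)))).
  assert (HM : 0 < M) by (unfold M; apply Rmult_lt_0_compat; lra).
  (* the cross terms [eta |a| (|p| + |q|)] are to be absorbed by [sg (p ^ 2 + q ^ 2)] and
     [de * lam * a ^ 2] *)
  set (eta := Rmin sg (de * lam)).
  assert (Heta : 0 < eta) by (unfold eta; apply Rmin_glb_lt; [| apply Rmult_lt_0_compat]; lra).
  assert (Heta1 : eta <= sg) by apply Rmin_l.
  assert (Heta2 : eta <= de * lam) by apply Rmin_r.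
  exists de, (eta / M); repeat split; try assumption.
  - apply Rdiv_lt_0_compat; lra.
  - intros a p q e He.
    assert (HeM : Rabs e * M <= eta).
    { apply Rmult_le_compat_r with (r := M) in He; [| lra].
      replace (eta / M * M) with eta in He by (field; lra). exact He. }
    assert (Hmix : Rabs (k5 * e * a * (2 * k3 * q - (k5 + (lam - k3)) * p))
                   <= eta * (Rabs a * (Rabs p + Rabs q))).
    { apply Rle_trans with (Rabs e * M * (Rabs a * (Rabs p + Rabs q))).
      - rewrite !Rabs_mult, (Rabs_pos_eq k5) by lra.
        assert (Rabs (2 * k3 * q - (k5 + (lam - k3)) * p)
                <= (2 * k3 + (k5 + (lam - k3))) * (Rabs p + Rabs q)).
        { eapply Rle_trans; [apply Rabs_triang |].
          rewrite Rabs_Ropp, !Rabs_mult, (Rabs_pos_eq 2), (Rabs_pos_eq k3),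
            (Rabs_pos_eq (k5 + (lam - k3))) by lra.
          pose proof (Rabs_pos p); pose proof (Rabs_pos q).
          assert (0 <= k3 * Rabs p) by (apply Rmult_le_pos; lra).
          assert (0 <= (k5 + (lam - k3)) * Rabs q) by (apply Rmult_le_pos; lra).
          nra. }
        replace (Rabs e * M * (Rabs a * (Rabs p + Rabs q)))
          with (k5 * Rabs e * Rabs a * ((2 * k3 + (k5 + (lam - k3))) * (Rabs p + Rabs q)))
          by (unfold M; ring).
        apply Rmult_le_compat_l; [| assumption].
        repeat apply Rmult_le_pos; try apply Rabs_pos; lra.
      - apply Rmult_le_compat_r; [| assumption].
        pose proof (Rabs_pos p); pose proof (Rabs_pos q); pose proof (Rabs_pos a).
        apply Rmult_le_pos; lra. }
    assert (HN : sg * (p ^ 2 + q ^ 2) <= (lam - k3 - k5) * expanding_form k3 k5 lam p q).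
    { unfold sg; rewrite Rmult_assoc; apply Rmult_le_compat_l; [lra | apply Hform]. }
    apply Rabs_le_between in Hmix.
    assert (Hap : Rabs (a * p) = Rabs a * Rabs p) by apply Rabs_mult.
    assert (Hap' : - (Rabs a * Rabs p) <= a * p).
    { rewrite <- Hap; pose proof (Rle_abs (- (a * p))) as Hx; rewrite Rabs_Ropp in Hx; lra. }
    rewrite <- (pow2_abs p), <- (pow2_abs q) in HN.
    assert (Ha2 : a ^ 2 = Rabs a ^ 2) by (symmetry; apply pow2_abs).
    assert (H2 : 2 * de * a * (lam * a + p) = 2 * de * lam * a ^ 2 + 2 * de * (a * p)) by ring.
    rewrite H2, Ha2.
    pose proof (Rabs_pos p) as Pp; pose proof (Rabs_pos q) as Pq; pose proof (Rabs_pos a) as Pa.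
    generalize dependent (Rabs p); intros p'.
    generalize dependent (Rabs q); intros q'.
    generalize dependent (Rabs a); intros a'. intros.
    assert (S1 : 2 * de * (a' * p') <= de * lam * a' ^ 2 + sg / 2 * p' ^ 2).
    { assert (0 <= de * lam * (a' - p' / lam) ^ 2).
      { apply Rmult_le_pos; [apply Rmult_le_pos; lra | apply pow2_ge_0]. }
      replace (de * lam * (a' - p' / lam) ^ 2)
        with (de * lam * a' ^ 2 - 2 * de * (a' * p') + de / lam * p' ^ 2) in H by (field; lra).
      assert (de / lam * p' ^ 2 <= sg / 2 * p' ^ 2); [| lra].
      apply Rmult_le_compat_r; [apply pow2_ge_0 |].
      apply Rmult_le_reg_r with lam; [lra |].
      replace (de / lam * lam) with de by (field; lra). lra. }
    assert (S2 : eta * (a' * p') <= de * lam * (a' ^ 2) / 2 + sg / 2 * p' ^ 2).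
    { pose proof (pow2_ge_0 (a' - p')). pose proof (pow2_ge_0 a'); pose proof (pow2_ge_0 p').
      assert (eta * (a' * p') <= eta * (a' ^ 2 / 2 + p' ^ 2 / 2)) by (apply Rmult_le_compat_l; nra).
      assert (eta * a' ^ 2 <= de * lam * a' ^ 2) by (apply Rmult_le_compat_r; lra).
      assert (eta * p' ^ 2 <= sg * p' ^ 2) by (apply Rmult_le_compat_r; lra).
      lra. }
    assert (S3 : eta * (a' * q') <= de * lam * (a' ^ 2) / 2 + sg / 2 * q' ^ 2).
    { pose proof (pow2_ge_0 (a' - q')). pose proof (pow2_ge_0 a'); pose proof (pow2_ge_0 q').
      assert (eta * (a' * q') <= eta * (a' ^ 2 / 2 + q' ^ 2 / 2)) by (apply Rmult_le_compat_l; nra).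
      assert (eta * a' ^ 2 <= de * lam * a' ^ 2) by (apply Rmult_le_compat_r; lra).
      assert (eta * q' ^ 2 <= sg * q' ^ 2) by (apply Rmult_le_compat_r; lra).
      lra. }
    pose proof (pow2_ge_0 q').
    assert (0 <= sg * q' ^ 2) by (apply Rmult_le_pos; lra).
    assert (HH : de * (-(a' * p')) <= de * (a * p)) by (apply Rmult_le_compat_l; lra).
    lra.
  - intros a p q Hq.
    specialize (Hform p q).
    assert (Hpq : nu * (p ^ 2 + q ^ 2) <= de * a ^ 2) by lra.
    pose proof (pow2_ge_0 p) as Hp2; pose proof (pow2_ge_0 q) as Hq2; pose proof (pow2_ge_0 a) as Ha2.
    destruct (Req_dec a 0) as [Ha | Ha].
    + left. rewrite Ha in Hpq.
      assert (p ^ 2 + q ^ 2 <= 0) by (apply Rnot_lt_le; intros; nra).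
      repeat split; nra.
    + right.
      assert (Hapos : 0 < Rabs a) by (apply Rabs_pos_lt; assumption).
      assert (Ha2' : 0 < a ^ 2) by (rewrite <- pow2_abs; apply pow_lt; assumption).
      assert (Hlt : forall u v, 0 < v -> de <= nu * v ^ 2 / 2 -> nu * u ^ 2 <= de * a ^ 2 ->
                Rabs u < v * Rabs a).
      { intros u v Hv Hdv Hu.
        assert (u ^ 2 < (v * Rabs a) ^ 2).
        { rewrite Rpow_mult_distr, pow2_abs.
          apply Rmult_lt_reg_l with nu; [lra |].
          assert (de * a ^ 2 <= nu * v ^ 2 / 2 * a ^ 2) by (apply Rmult_le_compat_r; lra).
          assert (0 < nu * v ^ 2 * a ^ 2); [| lra].
          apply Rmult_lt_0_compat; [apply Rmult_lt_0_compat; [| apply pow_lt] |]; lra. }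
        apply Rnot_le_lt; intros Hle.
        assert ((v * Rabs a) ^ 2 <= Rabs u ^ 2); [| rewrite pow2_abs in *; lra].
        apply pow_incr; split; [apply Rmult_le_pos; lra | assumption]. }
      assert (0 <= nu * p ^ 2) by (apply Rmult_le_pos; lra).
      assert (0 <= nu * q ^ 2) by (apply Rmult_le_pos; lra).
      split; apply Hlt; try lra.
Qed.

Lemma is_lim_0_scal (f : R -> R) (r : R) :
  is_lim f p_infty 0 -> is_lim (fun t => r * f t) p_infty 0.
Proof.
  intros Hf; pose proof (is_lim_scal_l f r p_infty 0 Hf) as H.
  replace (Rbar_mult r 0) with (Finite 0) in H; [exact H |].
  simpl; rewrite Rmult_0_r; reflexivity.
Qed.

Lemma is_lim_0_plus (f g : R -> R) :
  is_lim f p_infty 0 -> is_lim g p_infty 0 -> is_lim (fun t => f t + g t) p_infty 0.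
Proof.
  intros Hf Hg; replace 0 with (0 + 0) by ring; apply (is_lim_plus' f g p_infty 0 0 Hf Hg).
Qed.

Lemma is_lim_0_mult (f g : R -> R) :
  is_lim f p_infty 0 -> is_lim g p_infty 0 -> is_lim (fun t => f t * g t) p_infty 0.
Proof.
  intros Hf Hg.
  replace (Finite 0) with (Rbar_mult 0 0) by (simpl; f_equal; ring).
  apply (is_lim_mult f g p_infty 0 0 Hf Hg I).
Qed.

Lemma is_lim_eventually_near (f : R -> R) (l eps : R) :
  is_lim f p_infty l -> 0 < eps ->
  exists T, 0 <= T /\ forall t, T <= t -> Rabs (f t - l) < eps.
Proof.
  intros Hf He.
  apply is_lim_spec in Hf; destruct (Hf (mkposreal _ He)) as [M HM]; simpl in HM.
  exists (Rmax 0 (M + 1)); split; [apply Rmax_l |].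
  intros t Ht; apply HM; pose proof (Rmax_r 0 (M + 1)); lra.
Qed.

Lemma vanishing_nondecreasing_nonpos (f : R -> R) (T : R) :
  is_lim f p_infty 0 ->
  (forall s t, T <= s <= t -> f s <= f t) ->
  forall t, T <= t -> f t <= 0.
Proof.
  intros Hl Hmono t Ht.
  apply Rnot_lt_le; intros Hpos.
  destruct (is_lim_eventually_near f 0 (f t) Hl Hpos) as [T' [_ HT']].
  pose proof (Rmax_l T' t); pose proof (Rmax_r T' t).
  specialize (HT' (Rmax T' t) ltac:(assumption)).
  specialize (Hmono t (Rmax T' t) ltac:(lra)).
  apply Rabs_lt_between in HT'; lra.
Qed.

Definition signed_at (a b c : R -> R) (t : R) : Prop :=
  (a t = 0 /\ b t = 0 /\ c t = 0) \/ positive_at a b c t \/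
  positive_at (fun s => - a s) (fun s => - b s) (fun s => - c s) t.

(** The function [Q = expanding_form - delta a ^ 2] is eventually nondecreasing and tends to 0,
    hence it is eventually nonpositive. *)
Lemma eventually_signed (k k3 k5 lam : R) (m a b c : R -> R) :
  0 < k3 -> 0 < k5 -> dominant_rate k k3 k5 lam ->
  cone_system k3 k5 m a b c ->
  is_lim m p_infty k ->
  is_lim a p_infty 0 -> is_lim b p_infty 0 -> is_lim c p_infty 0 ->
  exists T, 0 <= T /\ forall t, T <= t -> signed_at a b c t.
Proof.
  intros H3 H5 [Hlam Hchar] [Hc Hd] Lm La Lb Lc.
  destruct (cone_form k3 k5 lam H3 H5 Hlam) as [de [eps [Hde [Heps [Hgrow Hcone]]]]].
  destruct (is_lim_eventually_near m k eps Lm Heps) as [T [HT0 HT]].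
  set (r := lam * (lam - k3) / k3).
  assert (Hr : 0 < r) by (unfold r; apply Rdiv_lt_0_compat; nra).
  set (p := fun t => b t - lam * a t).
  set (q := fun t => c t - r * a t).
  set (Q := fun t => expanding_form k3 k5 lam (p t) (q t) - de * a t ^ 2).
  assert (Lp : is_lim p p_infty 0).
  { apply (is_lim_ext (fun t => b t + (- lam) * a t)); [intros; unfold p; ring |].
    apply is_lim_0_plus; [| apply is_lim_0_scal]; assumption. }
  assert (Lq : is_lim q p_infty 0).
  { apply (is_lim_ext (fun t => c t + (- r) * a t)); [intros; unfold q; ring |].
    apply is_lim_0_plus; [| apply is_lim_0_scal]; assumption. }
  assert (LQ : is_lim Q p_infty 0).
  { apply (is_lim_ext (fun t => (r * (p t * p t) + (- (k5 + (lam - k3))) * (p t * q t))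
                               + (k3 * (q t * q t) + (- de) * (a t * a t)))).
    - intros t; unfold Q, expanding_form; fold r; ring.
    - repeat apply is_lim_0_plus; apply is_lim_0_scal, is_lim_0_mult; assumption. }
  set (dQ := fun t => (lam - k3 - k5) * expanding_form k3 k5 lam (p t) (q t)
            + k5 * (k - m t) * a t * (2 * k3 * q t - (k5 + (lam - k3)) * p t)
            + 2 * de * a t * (lam * a t + p t)).
  assert (Hk : k = lam * (lam - k3) * (lam - k5) / (k3 * k5)).
  { rewrite Hchar; field; lra. }
  exists T; split; [assumption |]; intros t Ht.
  assert (HQ : Q t <= 0).
  { apply (vanishing_nondecreasing_nonpos Q T LQ); [| assumption].
    intros s u Hsu.
    apply (le_of_derive_nonneg Q dQ); try lra.
    - intros v Hv.
      destruct (Hd v) as [da [db dc]]; [lra |].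
      unfold Q, dQ, expanding_form, p, q; auto_derive.
      + repeat split; eexists; eassumption.
      + subst_derive da; subst_derive db; subst_derive dc.
        unfold r; rewrite Hk; field; lra.
    - intros v Hv; destruct (Hc v) as [Ca [Cb Cc]].
      apply continuity_pt_filterlim; apply continuity_pt_filterlim in Ca, Cb, Cc.
      unfold Q, expanding_form, p, q; reg; assumption.
    - intros v Hv; apply Hgrow.
      rewrite Rabs_minus_sym; apply Rlt_le, HT; lra. }
  destruct (Hcone (a t) (p t) (q t)) as [[Ha [Hp Hq]] | [Hp Hq]].
  - unfold Q in HQ; lra.
  - left; unfold p, q in Hp, Hq; rewrite Ha in *; lra.
  - right; fold r in Hq; unfold p in Hp; unfold q in Hq; unfold positive_at.
    apply Rabs_lt_between in Hp, Hq.
    destruct (Rtotal_order (a t) 0) as [Ha | [Ha | Ha]].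
    + rewrite Rabs_left in Hp, Hq by assumption; right; lra.
    + rewrite Ha, Rabs_R0 in Hp, Hq; lra.
    + rewrite Rabs_right in Hp, Hq by lra; left; lra.
Qed.

Lemma cone_system_opp (k3 k5 : R) (m a b c : R -> R) :
  cone_system k3 k5 m a b c ->
  cone_system k3 k5 m (fun s => - a s) (fun s => - b s) (fun s => - c s).
Proof.
  intros [Hc Hd]; split.
  - intros t; destruct (Hc t) as [Ca [Cb Cc]].
    repeat split; [apply (continuous_opp a) | apply (continuous_opp b) | apply (continuous_opp c)];
      assumption.
  - intros t Ht; destruct (Hd t Ht) as [da [db dc]].
    split; [| split]; auto_derive; try (eexists; eassumption).
    + subst_derive da; ring.
    + subst_derive db; ring.
    + subst_derive dc; ring.
Qed.

(** The sign found at a late time propagates back to time 0; it is the same at all late times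
    because two different signs would both propagate back to a common earlier time. *)
Lemma vanishing_solution_signed (k k3 k5 lam : R) (m a b c : R -> R) :
  0 < k3 -> 0 < k5 -> dominant_rate k k3 k5 lam ->
  cone_system k3 k5 m a b c ->
  (forall t, 0 <= t -> 0 < m t) ->
  (forall T, exists M, forall t, 0 <= t <= T -> m t <= M) ->
  is_lim m p_infty k ->
  is_lim a p_infty 0 -> is_lim b p_infty 0 -> is_lim c p_infty 0 ->
  (forall t, 0 <= t -> a t = 0 /\ b t = 0 /\ c t = 0) \/
  (forall t, 0 <= t -> positive_at a b c t) \/
  (forall t, 0 <= t -> positive_at (fun s => - a s) (fun s => - b s) (fun s => - c s) t).
Proof.
  intros H3 H5 Hlam Hsys Hm HM Lm La Lb Lc.
  destruct (eventually_signed k k3 k5 lam m a b c) as [T [HT0 HT]]; try assumption.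
  assert (Hpos : forall t, T <= t -> positive_at a b c t ->
            forall s, 0 <= s <= t -> positive_at a b c s).
  { intros t _; apply (cone_backward_invariant k3 k5 m); assumption. }
  assert (Hneg : forall t, T <= t ->
            positive_at (fun s => - a s) (fun s => - b s) (fun s => - c s) t ->
            forall s, 0 <= s <= t ->
            positive_at (fun s => - a s) (fun s => - b s) (fun s => - c s) s).
  { intros t _; apply (cone_backward_invariant k3 k5 m); try assumption.
    apply cone_system_opp; assumption. }
  assert (Hzero : forall t, T <= t -> a t = 0 /\ b t = 0 /\ c t = 0 ->
            forall s, 0 <= s <= t -> a s = 0 /\ b s = 0 /\ c s = 0).
  { intros t Ht [Ha [Hb Hcc]]; destruct (HM t) as [M HMt].
    apply (zero_backward k3 k5 m a b c t M); try assumption.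
    intros s Hs; split; [apply Hm; lra | apply HMt; assumption]. }
  unfold signed_at, positive_at in *.
  destruct (HT T (Rle_refl T)) as [H | [H | H]]; [left | right; left | right; right];
    intros t Ht; destruct (Rle_lt_dec t T) as [HtT | HtT];
    try (apply (Hzero T); [lra | assumption | lra]);
    try (apply (Hpos T); [lra | assumption | lra]);
    try (apply (Hneg T); [lra | assumption | lra]);
    destruct (HT t (Rlt_le _ _ HtT)) as [H' | [H' | H']]; try assumption; exfalso.
  - specialize (Hpos t (Rlt_le _ _ HtT) H' T ltac:(lra)); cbv beta in *; lra.
  - specialize (Hneg t (Rlt_le _ _ HtT) H' T ltac:(lra)); cbv beta in *; lra.
  - specialize (Hzero t (Rlt_le _ _ HtT) H' T ltac:(lra)); cbv beta in *; lra.
  - specialize (Hneg t (Rlt_le _ _ HtT) H' T ltac:(lra)); cbv beta in *; lra.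
  - specialize (Hzero t (Rlt_le _ _ HtT) H' T ltac:(lra)); cbv beta in *; lra.
  - specialize (Hpos t (Rlt_le _ _ HtT) H' T ltac:(lra)); cbv beta in *; lra.
Qed.

(** * Solving y' = kap y + f from minus infinity *)

Definition decays (lam : R) (f : R -> R) : Prop :=
  (forall s, continuous f s) /\
  exists C, forall s, s <= 0 -> Rabs (f s) <= C * exp (lam * s).

Lemma exp_small (rho C e s : R) :
  0 < rho -> 0 < e -> exists u, u <= s /\ u <= 0 /\ C * exp (rho * u) < e.
Proof.
  intros Hr He.
  set (X := Rabs C / e).
  assert (HX : 0 <= X) by (apply Rdiv_le_0_compat; [apply Rabs_pos | assumption]).
  set (u := Rmin (Rmin s 0) (- (X / rho))).
  exists u.
  assert (Hu : u <= Rmin s 0) by apply Rmin_l.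
  assert (Hu2 : u <= - (X / rho)) by apply Rmin_r.
  pose proof (Rmin_l s 0); pose proof (Rmin_r s 0).
  split; [lra | split; [lra |]].
  assert (H1 : X <= - (rho * u)).
  { apply Rmult_le_compat_l with (r := rho) in Hu2; [| lra].
    replace (rho * - (X / rho)) with (- X) in Hu2 by (field; lra). lra. }
  assert (H2 : 1 + X <= exp (- (rho * u))).
  { pose proof (exp_ineq1_le (- (rho * u))); lra. }
  assert (H3 : exp (rho * u) * exp (- (rho * u)) = 1) by (rewrite <- exp_plus, Rplus_opp_r; apply exp_0).
  pose proof (exp_pos (rho * u)) as Hp.
  assert (H4 : exp (rho * u) * (1 + X) <= 1) by (rewrite <- H3; apply Rmult_le_compat_l; lra).
  assert (H5 : Rabs C * exp (rho * u) + e * exp (rho * u) <= e).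
  { apply Rmult_le_compat_l with (r := e) in H4; [| lra].
    replace (e * (exp (rho * u) * (1 + X))) with (Rabs C * exp (rho * u) + e * exp (rho * u)) in H4
      by (unfold X; field; lra). lra. }
  assert (0 < e * exp (rho * u)) by (apply Rmult_lt_0_compat; assumption).
  assert (C * exp (rho * u) <= Rabs C * exp (rho * u)) by (apply Rmult_le_compat_r; [lra | apply Rle_abs]).
  lra.
Qed.

(** A function with [z' >= kap z] that decays faster than [exp (kap s)] at minus infinity is
    nonnegative.  All bounds on [resolvent] below are instances of this comparison. *)
Lemma decays_nonneg (lam kap : R) (z dz : R -> R) (s : R) :
  kap < lam -> decays lam z ->
  (forall u, is_derive z u (dz u)) ->
  (forall u, u <= s -> kap * z u <= dz u) ->
  0 <= z s.
Proof.
  intros Hk [Hc [C HC]] Hd Hle.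
  apply Rnot_lt_le; intros Hneg.
  pose proof (exp_pos (kap * s)) as Hes.
  destruct (exp_small (lam - kap) (C * exp (kap * s)) (- z s) s) as [u [Hus [Hu0 Hu]]];
    [lra | lra |].
  assert (Hg : z u * exp (kap * (s - u)) <= z s).
  { apply (gronwall_lower kap z dz); try assumption; intros v Hv;
      [apply Hd | apply Hc | apply Hle; lra]. }
  specialize (HC u Hu0); apply Rabs_le_between in HC.
  assert (Hb : - (C * exp (lam * u)) * exp (kap * (s - u)) <= z u * exp (kap * (s - u))).
  { apply Rmult_le_compat_r; [apply Rlt_le, exp_pos | lra]. }
  replace (- (C * exp (lam * u)) * exp (kap * (s - u)))
    with (- (C * exp (kap * s) * exp ((lam - kap) * u))) in Hb; [lra |].
  replace ((lam - kap) * u) with (lam * u + kap * - u) by ring.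
  replace (kap * (s - u)) with (kap * s + kap * - u) by ring.
  rewrite !exp_plus; ring.
Qed.

Lemma derive_RInt_from_0 (g : R -> R) (s : R) :
  (forall u, continuous g u) -> is_derive (RInt g 0) s (g s).
Proof.
  intros Cg.
  apply (is_derive_RInt g (RInt g 0) 0 s); [| apply Cg].
  apply filter_forall; intros u.
  apply (RInt_correct (V := R_CompleteNormedModule) g 0 u), (ex_RInt_continuous (V := R_CompleteNormedModule)).
  intros v _; apply Cg.
Qed.

(** The solution of [y' = kap y + f] that is given by the improper integral
    [exp (kap s) * int_(-oo)^s exp (- kap u) f u du].  The integral is split at 0 so that the
    part depending on [s] is proper and can be differentiated directly. *)
Definition resolvent (kap : R) (f : R -> R) (s : R) : R :=
  let g := fun u => exp (- (kap * u)) * f u in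
  exp (kap * s) * (RInt g 0 s - real (Lim_seq (fun n => RInt g 0 (- INR n)))).

Lemma resolvent_derive (kap : R) (f : R -> R) (s : R) :
  (forall u, continuous f u) ->
  is_derive (resolvent kap f) s (kap * resolvent kap f s + f s).
Proof.
  intros Hc.
  set (g := fun u => exp (- (kap * u)) * f u).
  assert (Cg : forall u, continuous g u).
  { intros u; pose proof (Hc u) as Cu.
    apply continuity_pt_filterlim; apply continuity_pt_filterlim in Cu; unfold g; reg; assumption. }
  assert (dH : is_derive (RInt g 0) s (g s)).
  { apply derive_RInt_from_0, Cg. }
  unfold resolvent; fold g.
  generalize (real (Lim_seq (fun n => RInt g 0 (- INR n)))); intros l.
  revert dH; generalize (RInt g 0); intros H dH.
  auto_derive.
  - eexists; exact dH.
  - subst_derive dH; unfold g.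
    assert (He : exp (kap * s) * exp (- (kap * s)) = 1) by (rewrite <- exp_plus, Rplus_opp_r; apply exp_0).
    transitivity (kap * (exp (kap * s) * (H s - l)) + (exp (kap * s) * exp (- (kap * s))) * f s);
      [ring | rewrite He; ring].
Qed.

(** With [H] the primitive of [exp (- kap u) f u], both [H + E] and [- H + E] are nondecreasing
    on the negative half-line for a multiple [E] of [exp ((lam - kap) s)].  This gives both the
    convergence of the improper integral and the bound [E] on its tail. *)
Lemma resolvent_decays (lam kap : R) (f : R -> R) :
  kap < lam -> decays lam f -> decays lam (resolvent kap f).
Proof.
  intros Hk [Hc [C HC]].
  split.
  { intros s; apply (ex_derive_continuous (resolvent kap f)); eexists; apply resolvent_derive, Hc. }
  set (g := fun u => exp (- (kap * u)) * f u).
  set (H := RInt g 0).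
  set (rho := lam - kap).
  assert (Hrho : 0 < rho) by (unfold rho; lra).
  assert (Cg : forall u, continuous g u).
  { intros u; pose proof (Hc u) as Cu.
    apply continuity_pt_filterlim; apply continuity_pt_filterlim in Cu; unfold g; reg; assumption. }
  assert (dH : forall u, is_derive H u (g u)).
  { intros u; apply derive_RInt_from_0, Cg. }
  assert (CH : forall u, continuous H u).
  { intros u; apply (ex_derive_continuous H); eexists; apply dH. }
  assert (Hg : forall u, u <= 0 -> Rabs (g u) <= C * exp (rho * u)).
  { intros u Hu; unfold g.
    rewrite Rabs_mult, (Rabs_pos_eq (exp _)) by (apply Rlt_le, exp_pos).
    replace (rho * u) with (- (kap * u) + lam * u) by (unfold rho; ring).
    rewrite exp_plus.
    apply Rle_trans with (exp (- (kap * u)) * (C * exp (lam * u))); [| right; ring].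
    apply Rmult_le_compat_l; [apply Rlt_le, exp_pos | apply HC, Hu]. }
  set (E := fun u => C / rho * exp (rho * u)).
  assert (dE : forall u, is_derive E u (C * exp (rho * u))).
  { intros u; unfold E; auto_derive; [exact I | field; lra]. }
  assert (CE : forall u, continuous E u).
  { intros u; apply (ex_derive_continuous E); eexists; apply dE. }
  assert (Hup : forall u v, u <= v -> v <= 0 -> H u + E u <= H v + E v).
  { intros u v Huv Hv.
    apply (le_of_derive_nonneg (fun x => H x + E x) (fun x => g x + C * exp (rho * x))); try assumption.
    - intros x _; apply (is_derive_plus H E); [apply dH | apply dE].
    - intros x _; apply (continuous_plus H E); [apply CH | apply CE].
    - intros x Hx; specialize (Hg x ltac:(lra)); apply Rabs_le_between in Hg; lra. }
  assert (Hdn : forall u v, u <= v -> v <= 0 -> H v - E v <= H u - E u).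
  { intros u v Huv Hv.
    cut (E u - H u <= E v - H v); [lra |].
    apply (le_of_derive_nonneg (fun x => E x - H x) (fun x => C * exp (rho * x) - g x)); try assumption.
    - intros x _; apply (is_derive_minus E H); [apply dE | apply dH].
    - intros x _; apply (continuous_minus E H); [apply CE | apply CH].
    - intros x Hx; specialize (Hg x ltac:(lra)); apply Rabs_le_between in Hg; lra. }
  assert (LE : is_lim_seq (fun n => E (- INR n)) 0).
  { apply is_lim_seq_spec; intros e.
    destruct (exp_small rho (C / rho) e 0 Hrho (cond_pos e)) as [u1 [Hu1 [_ He1]]].
    destruct (exp_small rho (- (C / rho)) e 0 Hrho (cond_pos e)) as [u2 [Hu2 [_ He2]]].
    destruct (nfloor_ex (- Rmin u1 u2)) as [N [HN HN']]; [pose proof (Rmin_l u1 u2); lra |].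
    exists (S N); intros n Hn.
    apply le_INR in Hn; rewrite S_INR in Hn.
    pose proof (Rmin_l u1 u2); pose proof (Rmin_r u1 u2).
    assert (Hmon : forall u, - INR n <= u -> exp (rho * - INR n) <= exp (rho * u)).
    { intros u Hu; destruct (Rle_lt_or_eq_dec _ _ Hu) as [Hlt | ->]; [| lra].
      apply Rlt_le, exp_increasing, Rmult_lt_compat_l; lra. }
    pose proof (Hmon u1 ltac:(lra)); pose proof (Hmon u2 ltac:(lra)).
    pose proof (exp_pos (rho * - INR n)).
    rewrite Rminus_0_r; unfold E.
    pose proof (cond_pos e).
    apply Rabs_def1; destruct (Rle_lt_dec 0 (C / rho)); nra. }
  assert (Ll : exists l : R, is_lim_seq (fun n => H (- INR n)) l).
  { destruct (ex_finite_lim_seq_decr (fun n => H (- INR n) + E (- INR n)) (H 0 - E 0 - 2 * Rabs (C / rho)))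
      as [l Hl].
    - intros n; apply Hup; rewrite ?S_INR; pose proof (pos_INR n); lra.
    - intros n; pose proof (pos_INR n).
      pose proof (Hdn (- INR n) 0 ltac:(lra) ltac:(lra)).
      assert (- (2 * Rabs (C / rho)) <= 2 * E (- INR n)); [| lra].
      unfold E. pose proof (exp_pos (rho * - INR n)).
      assert (exp (rho * - INR n) <= 1).
      { rewrite <- exp_0; destruct (Req_dec (INR n) 0) as [-> | ?].
        - rewrite Ropp_0, Rmult_0_r; lra.
        - apply Rlt_le, exp_increasing; nra. }
      pose proof (Rabs_pos (C / rho)). pose proof (Rabs_maj2 (C / rho)).
      assert (Rabs (C / rho) * exp (rho * - INR n) <= Rabs (C / rho)) by nra.
      nra.
    - exists l.
      apply (is_lim_seq_ext (fun n => (H (- INR n) + E (- INR n)) - E (- INR n))); [intros; ring |].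
      replace (Finite l) with (Finite (l - 0)) by (f_equal; ring).
      apply (is_lim_seq_minus' _ _ l 0 Hl LE). }
  destruct Ll as [l Hl].
  assert (Hlim : real (Lim_seq (fun n => RInt g 0 (- INR n))) = l).
  { change (fun n => RInt g 0 (- INR n)) with (fun n => H (- INR n)).
    rewrite (is_lim_seq_unique _ _ Hl); reflexivity. }
  exists (C / rho); intros s Hs.
  unfold resolvent; fold g; rewrite Hlim; fold (H s).
  assert (HE : Rabs (H s - l) <= E s).
  { assert (Hev : exists N : nat, forall n, (N <= n)%nat -> - INR n <= s).
    { destruct (nfloor_ex (- s)) as [N [HN HN']]; [lra |].
      exists (S N); intros n Hn; apply le_INR in Hn; rewrite S_INR in Hn; lra. }
    destruct Hev as [N HN].
    assert (l + 0 <= H s + E s).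
    { apply (is_lim_seq_le_loc (fun n => H (- INR n) + E (- INR n)) (fun _ => H s + E s) (l + 0) (H s + E s)).
      - exists N; intros n Hn; apply Hup; [apply HN, Hn | assumption].
      - apply is_lim_seq_plus'; assumption.
      - apply is_lim_seq_const. }
    assert (H s - E s <= l - 0).
    { apply (is_lim_seq_le_loc (fun _ => H s - E s) (fun n => H (- INR n) - E (- INR n)) (H s - E s) (l - 0)).
      - exists N; intros n Hn; apply Hdn; [apply HN, Hn | assumption].
      - apply is_lim_seq_const.
      - apply is_lim_seq_minus'; assumption. }
    apply Rabs_le; lra. }
  rewrite Rabs_mult, (Rabs_pos_eq (exp _)) by (apply Rlt_le, exp_pos).
  apply Rle_trans with (exp (kap * s) * E s).
  - apply Rmult_le_compat_l; [apply Rlt_le, exp_pos | assumption].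
  - unfold E; replace (lam * s) with (kap * s + rho * s) by (unfold rho; ring).
    rewrite exp_plus; right; ring.
Qed.

Lemma decays_plus (lam : R) (f g : R -> R) :
  decays lam f -> decays lam g -> decays lam (fun s => f s + g s).
Proof.
  intros [Cf [C HC]] [Cg [D HD]]; split.
  - intros s; apply (continuous_plus f g); [apply Cf | apply Cg].
  - exists (C + D); intros s Hs; rewrite Rmult_plus_distr_r.
    eapply Rle_trans; [apply Rabs_triang |].
    apply Rplus_le_compat; [apply HC | apply HD]; assumption.
Qed.

Lemma decays_scal (lam r : R) (f : R -> R) :
  decays lam f -> decays lam (fun s => r * f s).
Proof.
  intros [Cf [C HC]]; split.
  - intros s; apply (continuous_scal_r r f), Cf.
  - exists (Rabs r * C); intros s Hs; rewrite Rabs_mult, Rmult_assoc.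
    apply Rmult_le_compat_l; [apply Rabs_pos | apply HC, Hs].
Qed.

Lemma decays_minus (lam : R) (f g : R -> R) :
  decays lam f -> decays lam g -> decays lam (fun s => f s - g s).
Proof.
  intros Hf Hg.
  replace (fun s => f s - g s) with (fun s => f s + (-1) * g s)
    by (apply functional_extensionality; intros s; ring).
  apply decays_plus; [| apply decays_scal]; assumption.
Qed.

Lemma decays_exp (lam rho : R) : lam <= rho -> decays lam (fun s => exp (rho * s)).
Proof.
  intros Hr; split.
  - intros s; apply continuity_pt_filterlim; reg.
  - exists 1; intros s Hs; rewrite Rabs_pos_eq, Rmult_1_l by (apply Rlt_le, exp_pos).
    apply exp_monotone; nra.
Qed.

(** A supersolution lies above the solution, even if it is one only up to time [s]. *)
Lemma resolvent_le (lam kap : R) (f Y dY : R -> R) (s : R) :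
  kap < lam -> decays lam f -> decays lam Y ->
  (forall u, is_derive Y u (dY u)) ->
  (forall u, u <= s -> kap * Y u + f u <= dY u) ->
  resolvent kap f s <= Y s.
Proof.
  intros Hk Hf HY HdY Hle.
  cut (0 <= Y s - resolvent kap f s); [lra |].
  apply (decays_nonneg lam kap (fun u => Y u - resolvent kap f u)
           (fun u => dY u - (kap * resolvent kap f u + f u))); [assumption | | |].
  - apply decays_minus, resolvent_decays; assumption.
  - intros u; apply (is_derive_minus Y (resolvent kap f)); [apply HdY | apply resolvent_derive, Hf].
  - intros u Hu; specialize (Hle u Hu); lra.
Qed.

Lemma resolvent_ge (lam kap : R) (f Y dY : R -> R) (s : R) :
  kap < lam -> decays lam f -> decays lam Y ->
  (forall u, is_derive Y u (dY u)) ->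
  (forall u, u <= s -> dY u <= kap * Y u + f u) ->
  Y s <= resolvent kap f s.
Proof.
  intros Hk Hf HY HdY Hle.
  cut (0 <= resolvent kap f s - Y s); [lra |].
  apply (decays_nonneg lam kap (fun u => resolvent kap f u - Y u)
           (fun u => (kap * resolvent kap f u + f u) - dY u)); [assumption | | |].
  - apply decays_minus; [apply resolvent_decays |]; assumption.
  - intros u; apply (is_derive_minus (resolvent kap f) Y); [apply resolvent_derive, Hf | apply HdY].
  - intros u Hu; specialize (Hle u Hu); lra.
Qed.

Lemma resolvent_unique (lam kap : R) (f Y : R -> R) :
  kap < lam -> decays lam f -> decays lam Y ->
  (forall u, is_derive Y u (kap * Y u + f u)) ->
  resolvent kap f = Y.
Proof.
  intros Hk Hf HY HdY; apply functional_extensionality; intros s.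
  apply Rle_antisym;
    [apply (resolvent_le lam kap f Y (fun u => kap * Y u + f u))
    |apply (resolvent_ge lam kap f Y (fun u => kap * Y u + f u))]; try assumption; intros; lra.
Qed.

Lemma resolvent_minus (lam kap : R) (f g : R -> R) :
  kap < lam -> decays lam f -> decays lam g ->
  resolvent kap (fun s => f s - g s) = (fun s => resolvent kap f s - resolvent kap g s).
Proof.
  intros Hk Hf Hg.
  apply (resolvent_unique lam); [assumption | apply decays_minus; assumption | |].
  - apply decays_minus; apply resolvent_decays; assumption.
  - intros u.
    replace (kap * (resolvent kap f u - resolvent kap g u) + (f u - g u))
      with ((kap * resolvent kap f u + f u) - (kap * resolvent kap g u + g u)) by ring.
    apply (is_derive_minus (resolvent kap f) (resolvent kap g)); apply resolvent_derive; [apply Hf | apply Hg].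
Qed.

Lemma resolvent_exp (lam kap rho C : R) :
  kap < lam -> lam <= rho ->
  resolvent kap (fun s => C * exp (rho * s)) = (fun s => C / (rho - kap) * exp (rho * s)).
Proof.
  intros Hk Hr; apply (resolvent_unique lam).
  - assumption.
  - apply decays_scal, decays_exp; assumption.
  - apply decays_scal, decays_exp; assumption.
  - intros u; auto_derive; [exact I | field; lra].
Qed.

Lemma resolvent_nonneg (lam kap : R) (f : R -> R) (s : R) :
  kap < lam -> decays lam f -> (forall u, 0 <= f u) -> 0 <= resolvent kap f s.
Proof.
  intros Hk Hf Hp.
  apply (resolvent_ge lam kap f (fun _ => 0) (fun _ => 0)); try assumption.
  - split; [intros u; apply continuous_const |].
    exists 0; intros; rewrite Rabs_R0; lra.
  - intros u; apply (is_derive_const (K := R_AbsRing) (V := R_NormedModule) 0 u).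
  - intros u _; specialize (Hp u); lra.
Qed.

(** The weight of the contraction below is a sum of two exponentials, hence bounds of this
    shape. *)
Lemma resolvent_abs_le (lam kap : R) (f : R -> R) (C1 r1 C2 r2 : R) :
  kap < lam -> lam <= r1 -> lam <= r2 -> decays lam f ->
  (forall s, Rabs (f s) <= C1 * exp (r1 * s) + C2 * exp (r2 * s)) ->
  forall s, Rabs (resolvent kap f s) <= C1 / (r1 - kap) * exp (r1 * s) + C2 / (r2 - kap) * exp (r2 * s).
Proof.
  intros Hk H1 H2 Hf Hb s.
  set (Y := fun s => C1 / (r1 - kap) * exp (r1 * s) + C2 / (r2 - kap) * exp (r2 * s)).
  set (dY := fun s => r1 * (C1 / (r1 - kap)) * exp (r1 * s) + r2 * (C2 / (r2 - kap)) * exp (r2 * s)).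
  assert (HY : decays lam Y) by (apply decays_plus; apply decays_scal, decays_exp; assumption).
  assert (HdY : forall u, is_derive Y u (dY u)).
  { intros u; unfold Y, dY; auto_derive; [exact I | ring]. }
  assert (Heq : forall u, dY u = kap * Y u + (C1 * exp (r1 * u) + C2 * exp (r2 * u))).
  { intros u; unfold Y, dY; field; lra. }
  change (Rabs (resolvent kap f s) <= Y s); apply Rabs_le; split.
  - apply (resolvent_ge lam kap f (fun u => - Y u) (fun u => - dY u)); try assumption.
    + replace (fun u => - Y u) with (fun u => -1 * Y u)
        by (apply functional_extensionality; intros; ring).
      apply decays_scal; assumption.
    + intros u; apply (is_derive_opp Y), HdY.
    + intros u _; rewrite Heq; specialize (Hb u); apply Rabs_le_between in Hb; lra.
  - apply (resolvent_le lam kap f Y dY); try assumption.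
    intros u _; rewrite Heq; specialize (Hb u); apply Rabs_le_between in Hb; lra.
Qed.

(** * The integral operator of the system *)

(** In reversed time the system is [a' = b], [b' = k3 (b + c)], [c' = k5 (c + G a)]; solving the
    three equations in turn from minus infinity turns [f = G o a] into [a]. *)
Definition cascade (k3 k5 : R) (f : R -> R) : R -> R :=
  resolvent 0 (fun s => k3 * resolvent k3 (fun u => k5 * resolvent k5 f u) s).

(** The factor by which [cascade] multiplies [exp (rho s)]. *)
Definition gain (k3 k5 rho : R) : R := k3 * k5 / (rho * (rho - k3) * (rho - k5)).

Lemma cascade_decays (lam k3 k5 : R) (f : R -> R) :
  0 < lam -> k3 < lam -> k5 < lam -> decays lam f -> decays lam (cascade k3 k5 f).
Proof.
  intros H0 H3 H5 Hf.
  apply resolvent_decays; [assumption |]; apply decays_scal, resolvent_decays; [assumption |].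
  apply decays_scal, resolvent_decays; assumption.
Qed.

Lemma cascade_nonneg (lam k3 k5 : R) (f : R -> R) (s : R) :
  0 < k3 < lam -> 0 < k5 < lam -> decays lam f -> (forall u, 0 <= f u) ->
  0 <= cascade k3 k5 f s.
Proof.
  intros H3 H5 Hf Hp.
  apply (resolvent_nonneg lam); [lra | |].
  - apply decays_scal, resolvent_decays; [lra |]; apply decays_scal, resolvent_decays; [lra | assumption].
  - intros u; apply Rmult_le_pos; [lra |].
    apply (resolvent_nonneg lam); [lra | |].
    + apply decays_scal, resolvent_decays; [lra | assumption].
    + intros v; apply Rmult_le_pos; [lra |]; apply (resolvent_nonneg lam); [lra | |]; assumption.
Qed.

Lemma cascade_minus (lam k3 k5 : R) (f g : R -> R) :
  0 < lam -> k3 < lam -> k5 < lam -> decays lam f -> decays lam g ->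
  cascade k3 k5 (fun s => f s - g s) = (fun s => cascade k3 k5 f s - cascade k3 k5 g s).
Proof.
  intros H0 H3 H5 Hf Hg; unfold cascade.
  rewrite (resolvent_minus lam k5 f g) by assumption.
  replace (fun u => k5 * (resolvent k5 f u - resolvent k5 g u))
    with (fun u => k5 * resolvent k5 f u - k5 * resolvent k5 g u)
    by (apply functional_extensionality; intros; ring).
  rewrite (resolvent_minus lam k3) by (try assumption; apply decays_scal, resolvent_decays; assumption).
  replace (fun s => k3 * (resolvent k3 (fun u => k5 * resolvent k5 f u) s
                          - resolvent k3 (fun u => k5 * resolvent k5 g u) s))
    with (fun s => k3 * resolvent k3 (fun u => k5 * resolvent k5 f u) s
                   - k3 * resolvent k3 (fun u => k5 * resolvent k5 g u) s)
    by (apply functional_extensionality; intros; ring).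
  apply (resolvent_minus lam 0); try assumption;
    apply decays_scal, resolvent_decays; try assumption; apply decays_scal, resolvent_decays; assumption.
Qed.

Lemma cascade_exp (lam k3 k5 C : R) :
  0 < lam -> k3 < lam -> k5 < lam ->
  cascade k3 k5 (fun s => C * exp (lam * s)) = (fun s => C * gain k3 k5 lam * exp (lam * s)).
Proof.
  intros H0 H3 H5; unfold cascade.
  rewrite (resolvent_exp lam) by lra.
  replace (fun u => k5 * (C / (lam - k5) * exp (lam * u)))
    with (fun u => (k5 * (C / (lam - k5))) * exp (lam * u))
    by (apply functional_extensionality; intros; ring).
  rewrite (resolvent_exp lam) by lra.
  replace (fun s => k3 * (k5 * (C / (lam - k5)) / (lam - k3) * exp (lam * s)))
    with (fun s => (k3 * (k5 * (C / (lam - k5)) / (lam - k3))) * exp (lam * s))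
    by (apply functional_extensionality; intros; ring).
  rewrite (resolvent_exp lam) by lra.
  apply functional_extensionality; intros s; unfold gain; field; lra.
Qed.

Lemma cascade_abs_le (lam k3 k5 : R) (f : R -> R) (C1 r1 C2 r2 : R) :
  0 < k3 < lam -> 0 < k5 < lam -> lam <= r1 -> lam <= r2 -> decays lam f ->
  (forall s, Rabs (f s) <= C1 * exp (r1 * s) + C2 * exp (r2 * s)) ->
  forall s, Rabs (cascade k3 k5 f s) <=
            C1 * gain k3 k5 r1 * exp (r1 * s) + C2 * gain k3 k5 r2 * exp (r2 * s).
Proof.
  intros H3 H5 H1 H2 Hf Hb s.
  assert (T5 : decays lam (resolvent k5 f)) by (apply resolvent_decays; [lra | assumption]).
  assert (T3 : decays lam (resolvent k3 (fun u => k5 * resolvent k5 f u)))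
    by (apply resolvent_decays; [lra | apply decays_scal; assumption]).
  pose proof (resolvent_abs_le lam k5 f C1 r1 C2 r2 ltac:(lra) H1 H2 Hf Hb) as B5.
  assert (B3 := resolvent_abs_le lam k3 (fun u => k5 * resolvent k5 f u) (k5 * (C1 / (r1 - k5))) r1
                  (k5 * (C2 / (r2 - k5))) r2 ltac:(lra) H1 H2 (decays_scal _ _ _ T5)).
  assert (B0 := resolvent_abs_le lam 0 (fun s => k3 * resolvent k3 (fun u => k5 * resolvent k5 f u) s)
                  (k3 * (k5 * (C1 / (r1 - k5)) / (r1 - k3))) r1
                  (k3 * (k5 * (C2 / (r2 - k5)) / (r2 - k3))) r2 ltac:(lra) H1 H2
                  (decays_scal _ _ _ T3)).
  replace (C1 * gain k3 k5 r1) with (k3 * (k5 * (C1 / (r1 - k5)) / (r1 - k3)) / (r1 - 0))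
    by (unfold gain; field; lra).
  replace (C2 * gain k3 k5 r2) with (k3 * (k5 * (C2 / (r2 - k5)) / (r2 - k3)) / (r2 - 0))
    by (unfold gain; field; lra).
  apply B0; clear B0; intros u.
  rewrite Rabs_mult, (Rabs_pos_eq k3), (Rmult_assoc k3 _ (exp (r1 * u))),
    (Rmult_assoc k3 _ (exp (r2 * u))), <- Rmult_plus_distr_l by lra.
  apply Rmult_le_compat_l; [lra |].
  apply B3; clear B3; intros v.
  rewrite Rabs_mult, (Rabs_pos_eq k5), (Rmult_assoc k5 _ (exp (r1 * v))),
    (Rmult_assoc k5 _ (exp (r2 * v))), <- Rmult_plus_distr_l by lra.
  apply Rmult_le_compat_l; [lra | apply B5].
Qed.

(** * A fixed-point theorem in a weighted distance *)

Lemma half_pow_vanishes (M e : R) : 0 < e -> exists n, M * (/ 2) ^ n < e.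
Proof.
  intros He.
  assert (HM : 0 < Rabs M + 1) by (pose proof (Rabs_pos M); lra).
  destruct (pow_lt_1_zero (/ 2) ltac:(rewrite Rabs_pos_eq; lra) (e / (Rabs M + 1))) as [N HN].
  - apply Rdiv_lt_0_compat; assumption.
  - exists N; specialize (HN N (le_n N)).
    assert (Hp : 0 < (/ 2) ^ N) by (apply pow_lt; lra).
    rewrite Rabs_pos_eq in HN by lra.
    apply Rmult_lt_compat_r with (r := Rabs M + 1) in HN; [| assumption].
    replace (e / (Rabs M + 1) * (Rabs M + 1)) with e in HN by (field; lra).
    pose proof (Rle_abs M). nra.
Qed.

(** Convergence is locally uniform because the weight is nondecreasing, hence bounded on
    half-lines; this keeps the limit continuous. *)
Lemma geometric_limit (u : nat -> R -> R) (w : R -> R) :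
  (forall s t, s <= t -> w s <= w t) ->
  (forall n s, continuous (u n) s) ->
  (forall n s, Rabs (u (S n) s - u n s) <= w s * (/ 2) ^ n) ->
  exists v, (forall s, continuous v s) /\
    forall n s, Rabs (u n s - v s) <= 2 * w s * (/ 2) ^ n.
Proof.
  intros Hw Hc Hstep.
  assert (Hp : forall n, 0 < (/ 2) ^ n) by (intros; apply pow_lt; lra).
  assert (Hw0 : forall s, 0 <= w s).
  { intros s; specialize (Hstep O s); pose proof (Rabs_pos (u 1%nat s - u O s)); simpl in Hstep; lra. }
  assert (Hfar : forall n p s, Rabs (u (n + p)%nat s - u n s)
                   <= 2 * w s * ((/ 2) ^ n - (/ 2) ^ (n + p))).
  { intros n p s; induction p as [|p IH].
    - rewrite Nat.add_0_r, !Rminus_diag, Rabs_R0; lra.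
    - rewrite Nat.add_succ_r.
      replace (u (S (n + p)) s - u n s)
        with ((u (S (n + p)) s - u (n + p)%nat s) + (u (n + p)%nat s - u n s)) by ring.
      eapply Rle_trans; [apply Rabs_triang |].
      specialize (Hstep (n + p)%nat s); simpl; lra. }
  assert (Hfar' : forall n m s, (n <= m)%nat -> Rabs (u m s - u n s) <= 2 * w s * (/ 2) ^ n).
  { intros n m s Hnm; replace m with (n + (m - n))%nat by lia.
    eapply Rle_trans; [apply Hfar |].
    apply Rmult_le_compat_l; [specialize (Hw0 s); lra |].
    specialize (Hp (n + (m - n))%nat); lra. }
  assert (Hlim : forall s, exists l : R, is_lim_seq (fun n => u n s) l).
  { intros s; apply ex_lim_seq_cauchy_corr; intros e.
    destruct (half_pow_vanishes (4 * w s) e (cond_pos e)) as [N HN].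
    exists N; intros n m Hn Hm.
    replace (u n s - u m s) with ((u n s - u N s) - (u m s - u N s)) by ring.
    eapply Rle_lt_trans; [apply Rabs_triang |]; rewrite Rabs_Ropp.
    pose proof (Hfar' N n s Hn); pose proof (Hfar' N m s Hm); lra. }
  set (v := fun s => real (Lim_seq (fun n => u n s))).
  assert (Hv : forall s, is_lim_seq (fun n => u n s) (v s)).
  { intros s; destruct (Hlim s) as [l Hl]; unfold v; rewrite (is_lim_seq_unique _ _ Hl); exact Hl. }
  assert (Hclose : forall n s, Rabs (u n s - v s) <= 2 * w s * (/ 2) ^ n).
  { intros n s.
    assert (Hl : is_lim_seq (fun m => Rabs (u m s - u n s)) (Rabs (v s - u n s))).
    { apply (is_lim_seq_abs _ (v s - u n s)).
      apply is_lim_seq_minus'; [apply Hv | apply is_lim_seq_const]. }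
    rewrite Rabs_minus_sym.
    apply (is_lim_seq_le_loc (fun m => Rabs (u m s - u n s)) (fun _ => 2 * w s * (/ 2) ^ n)
             (Rabs (v s - u n s)) (2 * w s * (/ 2) ^ n));
      [exists n; intros m Hm; apply Hfar', Hm | exact Hl | apply is_lim_seq_const]. }
  exists v; split; [| exact Hclose].
  intros s; apply continuity_pt_filterlim.
  set (r := mkposreal 1 Rlt_0_1).
  apply (CVU_continuity u v s r).
  - intros e He.
    destruct (half_pow_vanishes (2 * w (s + 1)) e He) as [N HN].
    exists N; intros n y Hn Hy.
    rewrite Rabs_minus_sym.
    eapply Rle_lt_trans; [| exact HN].
    eapply Rle_trans; [apply Hclose |].
    unfold Boule in Hy; simpl in Hy; apply Rabs_lt_between in Hy.
    assert (w y <= w (s + 1)) by (apply Hw; lra).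
    assert ((/ 2) ^ n <= (/ 2) ^ N).
    { replace n with (N + (n - N))%nat by lia; rewrite pow_add.
      assert ((/ 2) ^ (n - N) <= 1).
      { rewrite <- (pow1 (n - N)); apply pow_incr; lra. }
      specialize (Hp N); nra. }
    apply Rmult_le_compat; [specialize (Hw0 y); lra | apply Rlt_le, Hp | lra | assumption].
  - intros n y _; apply continuity_pt_filterlim, Hc.
  - unfold Boule; simpl; rewrite Rminus_diag, Rabs_R0; lra.
Qed.

(** The set on which the contraction is required: nonlinearities are Lipschitz with a small
    constant only near the starting function [u0]. *)
Definition admissible (lam : R) (u0 w u : R -> R) : Prop :=
  decays lam u /\ (forall s, 0 <= u s) /\ (forall s, Rabs (u s - u0 s) <= 2 * w s).

(** Banach's fixed-point argument for the distance [sup |u - v| / w].  Since the first step has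
    length at most 1 and the ratio is 1/2, all iterates stay within distance 2 of [u0]. *)
Lemma weighted_fixed_point (lam : R) (Phi : (R -> R) -> R -> R) (u0 w : R -> R) :
  (forall s t, s <= t -> w s <= w t) -> (forall s, 0 <= w s) -> decays lam w ->
  decays lam u0 -> (forall s, 0 <= u0 s) ->
  (forall u, decays lam u -> (forall s, 0 <= u s) ->
     decays lam (Phi u) /\ forall s, 0 <= Phi u s) ->
  (forall s, Rabs (Phi u0 s - u0 s) <= w s) ->
  (forall u v D, 0 <= D -> admissible lam u0 w u -> admissible lam u0 w v ->
     (forall s, Rabs (u s - v s) <= D * w s) ->
     forall s, Rabs (Phi u s - Phi v s) <= D / 2 * w s) ->
  exists u, admissible lam u0 w u /\ forall s, Phi u s = u s.
Proof.
  intros Hw Hw0 Tw T0 P0 Hpres Hdef Hcontr.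
  set (u := fix u n := match n with O => u0 | S n => Phi (u n) end).
  assert (Hp : forall n, 0 < (/ 2) ^ n) by (intros; apply pow_lt; lra).
  assert (Hu : forall n, decays lam (u n) /\ forall s, 0 <= u n s).
  { induction n as [|n IH]; [split; assumption | apply Hpres; apply IH]. }
  assert (Hn : forall n,
    (forall s, Rabs (u n s - u0 s) <= (2 - 2 * (/ 2) ^ n) * w s) /\
    (forall s, Rabs (u (S n) s - u n s) <= (/ 2) ^ n * w s)).
  { assert (Hadm : forall n, (forall s, Rabs (u n s - u0 s) <= (2 - 2 * (/ 2) ^ n) * w s) ->
              admissible lam u0 w (u n)).
    { intros n H; destruct (Hu n); split; [assumption | split; [assumption |]].
      intros s; eapply Rle_trans; [apply H |]; specialize (Hp n); specialize (Hw0 s); nra. }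
    induction n as [|n [IH1 IH2]].
    - split; intros s.
      + simpl; rewrite Rminus_diag, Rabs_R0; specialize (Hw0 s); lra.
      + simpl; rewrite Rmult_1_l; apply Hdef.
    - assert (H1 : forall s, Rabs (u (S n) s - u0 s) <= (2 - 2 * (/ 2) ^ (S n)) * w s).
      { intros s.
        replace (u (S n) s - u0 s) with ((u (S n) s - u n s) + (u n s - u0 s)) by ring.
        eapply Rle_trans; [apply Rabs_triang |].
        specialize (IH1 s); specialize (IH2 s).
        replace ((2 - 2 * (/ 2) ^ S n) * w s)
          with ((/ 2) ^ n * w s + (2 - 2 * (/ 2) ^ n) * w s) by (simpl; field).
        lra. }
      split; [exact H1 |].
      intros s; replace ((/ 2) ^ S n) with ((/ 2) ^ n / 2) by (simpl; field).
      apply (Hcontr (u (S n)) (u n)); [apply Rlt_le, Hp | apply Hadm, H1 | apply Hadm, IH1 | exact IH2]. }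
  destruct (geometric_limit u w Hw) as [v [Cv Hv]].
  { intros n; apply Hu. }
  { intros n s; rewrite Rmult_comm; apply Hn. }
  assert (Hv0 : forall s, Rabs (v s - u0 s) <= 2 * w s).
  { intros s; specialize (Hv O s); simpl in Hv; rewrite Rabs_minus_sym; lra. }
  assert (Av : admissible lam u0 w v).
  { split; [| split; [| exact Hv0]].
    - split; [exact Cv |].
      destruct T0 as [_ [C HC]]; destruct Tw as [_ [D HD]].
      exists (C + 2 * D); intros s Hs.
      replace (v s) with (u0 s + (v s - u0 s)) by ring.
      eapply Rle_trans; [apply Rabs_triang |].
      specialize (HC s Hs); specialize (HD s Hs); specialize (Hv0 s).
      pose proof (Rle_abs (w s)); lra.
    - intros s; apply Rnot_lt_le; intros Hneg.
      destruct (half_pow_vanishes (2 * w s) (- v s) ltac:(lra)) as [n Hn'].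
      specialize (Hv n s); apply Rabs_le_between in Hv.
      destruct (Hu n) as [_ Hpos]; specialize (Hpos s); lra. }
  exists v; split; [exact Av |].
  intros s.
  apply Rminus_diag_uniq.
  destruct (Req_dec (Phi v s - v s) 0) as [|Hne]; [assumption |]; exfalso.
  destruct (half_pow_vanishes (2 * w s) (Rabs (Phi v s - v s)) (Rabs_pos_lt _ Hne)) as [n Hn'].
  assert (Hun : admissible lam u0 w (u n)).
  { destruct (Hu n); split; [assumption | split; [assumption |]].
    intros t; eapply Rle_trans; [apply Hn |]; specialize (Hp n); specialize (Hw0 t); nra. }
  assert (H1 : Rabs (Phi v s - u (S n) s) <= 2 * (/ 2) ^ n / 2 * w s).
  { apply (Hcontr v (u n)); try assumption; [specialize (Hp n); lra |].
    intros t; rewrite Rabs_minus_sym; specialize (Hv n t); lra. }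
  pose proof (Hv (S n) s) as H2; simpl in H2.
  replace (Phi v s - v s) with ((Phi v s - u (S n) s) + (u (S n) s - v s)) in Hn' by ring.
  pose proof (Rabs_triang (Phi v s - u (S n) s) (u (S n) s - v s)).
  simpl in *; lra.
Qed.

(** * The orbit that leaves the equilibrium *)

(** The eigenvalue equation: [exp (lam s)] solves the linear problem [a = cascade (k a)]. *)
Lemma gain_dominant (k k3 k5 lam : R) :
  0 < k3 -> 0 < k5 -> 0 < k -> dominant_rate k k3 k5 lam -> k * gain k3 k5 lam = 1.
Proof.
  intros H3 H5 Hk [Hlam Hchar]; unfold gain; rewrite Hchar; field; lra.
Qed.

(** At the doubled rate every factor of the denominator at least doubles.  This provides the
    contraction near minus infinity, where the weight is [exp (2 lam s)]. *)
Lemma gain_double (k k3 k5 lam : R) :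
  0 < k3 -> 0 < k5 -> 0 < k -> dominant_rate k k3 k5 lam ->
  0 < gain k3 k5 (2 * lam) /\ 8 * k * gain k3 k5 (2 * lam) <= 1.
Proof.
  intros H3 H5 Hk [Hlam Hchar]; unfold gain.
  set (d := 2 * lam * (2 * lam - k3) * (2 * lam - k5)).
  assert (H35 : 0 < k3 * k5) by (apply Rmult_lt_0_compat; assumption).
  assert (Hd : 8 * (k3 * k5 * k) <= d).
  { rewrite <- Hchar; unfold d.
    replace (8 * (lam * (lam - k3) * (lam - k5)))
      with (2 * lam * ((2 * (lam - k3)) * (2 * (lam - k5)))) by ring.
    rewrite (Rmult_assoc (2 * lam)).
    apply Rmult_le_compat_l; [lra |].
    apply Rmult_le_compat; lra. }
  assert (Hkk : 0 < k3 * k5 * k) by (apply Rmult_lt_0_compat; assumption).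
  split; [apply Rdiv_lt_0_compat; lra |].
  apply Rmult_le_reg_r with d; [lra |].
  replace (8 * k * (k3 * k5 / d) * d) with (8 * (k3 * k5 * k)) by (field; lra).
  lra.
Qed.

(** A fast enough exponential weight turns any Lipschitz constant into a contraction; this
    handles the part of the orbit away from the equilibrium. *)
Lemma gain_small (k3 k5 lam X : R) :
  0 < k3 -> 0 < k5 -> k3 + k5 < lam -> 0 < X ->
  exists mu, 2 * lam <= mu /\ 0 < gain k3 k5 mu /\ X * gain k3 k5 mu <= 1.
Proof.
  intros H3 H5 Hlam HX.
  assert (H35 : 0 < k3 * k5) by (apply Rmult_lt_0_compat; assumption).
  assert (Hl2 : 0 < lam * lam) by (apply Rmult_lt_0_compat; lra).
  set (nu := X * (k3 * k5) / (lam * lam)).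
  assert (Hnu : 0 < nu) by (apply Rdiv_lt_0_compat; [apply Rmult_lt_0_compat |]; lra).
  exists (2 * lam + nu); set (mu := 2 * lam + nu).
  assert (Hmu : 2 * lam <= mu) by (unfold mu; lra).
  set (d := mu * (mu - k3) * (mu - k5)).
  assert (Hd : nu * (lam * lam) <= d).
  { unfold d; rewrite Rmult_assoc.
    apply Rmult_le_compat; [lra | lra | unfold mu; lra |].
    apply Rmult_le_compat; lra. }
  assert (Hnl : nu * (lam * lam) = X * (k3 * k5)) by (unfold nu; field; lra).
  assert (HXX : 0 < X * (k3 * k5)) by (apply Rmult_lt_0_compat; lra).
  unfold gain; fold d.
  split; [assumption | split; [apply Rdiv_lt_0_compat; lra |]].
  apply Rmult_le_reg_r with d; [lra |].
  replace (X * (k3 * k5 / d) * d) with (X * (k3 * k5)) by (field; lra).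
  lra.
Qed.

Definition unstable_orbit (k3 k5 : R) (G a b c : R -> R) : Prop :=
  forall s, is_derive a s (b s) /\
            is_derive b s (k3 * (b s + c s)) /\
            is_derive c s (k5 * (c s + G (a s))).

(** The weight is [exp (2 lam s)] plus an exponential of fast rate [mu] that overtakes it at
    [s0].  Before [s0] the iterates stay below 1/2, where [G] is quadratically close to [k x] and
    [2 k]-Lipschitz, and the small gain at rate [2 lam] suffices.  After [s0] only the global
    Lipschitz constant is available, and the rate [mu] is chosen to beat it.  The bounds at [s0]
    in the conclusion do not depend on [Lip]: they are what allows [G] to be the truncation of
    a function that is not globally Lipschitz, at a level computed from these bounds. *)
Lemma unstable_orbit_exists (k k3 k5 lam Lip : R) (G : R -> R) :
  0 < k3 -> 0 < k5 -> 0 < k -> dominant_rate k k3 k5 lam -> 0 <= Lip ->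
  (forall x, continuous G x) ->
  (forall x, 0 < x -> 0 < G x) ->
  (forall x y, 0 <= x -> 0 <= y -> Rabs (G x - G y) <= Lip * Rabs (x - y)) ->
  (forall x y, 0 <= x <= /2 -> 0 <= y <= /2 -> Rabs (G x - G y) <= 2 * k * Rabs (x - y)) ->
  (forall x, 0 <= x <= /2 -> Rabs (G x - k * x) <= 2 * k * x ^ 2) ->
  exists a b c s0,
    unstable_orbit k3 k5 G a b c /\
    decays lam a /\ decays lam b /\ decays lam c /\
    (forall s, positive_at a b c s) /\
    (forall s, s <= s0 -> a s <= /2) /\ b s0 <= lam /\ k * k5 / (lam - k5) / 32 <= c s0.
Proof.
  intros H3 H5 Hk Hdom HL CG HGpos HLip HLip2 HG2.
  pose proof Hdom as [Hlam Hchar].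
  pose proof (gain_dominant k k3 k5 lam H3 H5 Hk Hdom) as Hg1.
  destruct (gain_double k k3 k5 lam H3 H5 Hk Hdom) as [Hg2pos Hg2].
  destruct (gain_small k3 k5 lam (8 * (Lip + k)) H3 H5 Hlam ltac:(lra)) as [mu [Hmu [Hgmpos Hgm]]].
  (* so that [exp (lam * s0) = 1 / 8]: small enough for all admissible functions to lie between
     1/2 and 3/2 times [exp (lam * s)] up to time [s0] *)
  set (s0 := - ln 8 / lam).
  set (kappa := exp ((2 * lam - mu) * s0)).
  set (E := fun s => kappa * exp (mu * s)).
  set (w := fun s => exp (2 * lam * s) + E s).
  set (u0 := fun s => exp (lam * s)).
  assert (Hkappa : 0 < kappa) by apply exp_pos.
  assert (HEpos : forall s, 0 < E s) by (intros s; apply Rmult_lt_0_compat; [assumption | apply exp_pos]).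
  assert (Hu0s0 : u0 s0 = / 8).
  { unfold u0, s0; replace (lam * (- ln 8 / lam)) with (- ln 8) by (field; lra).
    rewrite exp_Ropp, exp_ln; lra. }
  assert (Hsq : forall s, exp (2 * lam * s) = u0 s * u0 s).
  { intros s; unfold u0; rewrite <- exp_plus; f_equal; ring. }
  assert (Hu0pos : forall s, 0 < u0 s) by (intros; apply exp_pos).
  assert (Hu0le : forall s, s <= s0 -> u0 s <= / 8).
  { intros s Hs; rewrite <- Hu0s0; apply exp_monotone; nra. }
  assert (Hu0ge : forall s, s0 <= s -> / 8 <= u0 s).
  { intros s Hs; rewrite <- Hu0s0; apply exp_monotone; nra. }
  assert (HEle : forall s, s <= s0 -> E s <= exp (2 * lam * s)).
  { intros s Hs; unfold E, kappa; rewrite <- exp_plus; apply exp_monotone; nra. }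
  assert (HEge : forall s, s0 <= s -> exp (2 * lam * s) <= E s).
  { intros s Hs; unfold E, kappa; rewrite <- exp_plus; apply exp_monotone; nra. }
  assert (Hw0 : forall s, 0 <= w s).
  { intros s; unfold w; pose proof (exp_pos (2 * lam * s)); specialize (HEpos s); lra. }
  assert (Tu0 : decays lam u0) by (apply decays_exp; lra).
  assert (Tw : decays lam w).
  { apply decays_plus; [apply decays_exp; lra | apply decays_scal, decays_exp; lra]. }
  assert (HG0 : G 0 = 0).
  { specialize (HG2 0 ltac:(lra)).
    replace (2 * k * 0 ^ 2) with 0 in HG2 by ring.
    replace (G 0 - k * 0) with (G 0) in HG2 by ring.
    pose proof (Rabs_pos (G 0)); destruct (Req_dec (G 0) 0); [assumption |].
    pose proof (Rabs_pos_lt (G 0) H0); lra. }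
  assert (TG : forall u, decays lam u -> (forall s, 0 <= u s) -> decays lam (fun s => G (u s))).
  { intros u [Cu [C HC]] Pu; split.
    - intros s; apply (continuous_comp u G); [apply Cu | apply CG].
    - exists (Lip * C); intros s Hs.
      specialize (HLip (u s) 0 (Pu s) ltac:(lra)); rewrite HG0, !Rminus_0_r in HLip.
      eapply Rle_trans; [exact HLip |]; rewrite Rmult_assoc.
      apply Rmult_le_compat_l; [assumption | apply HC, Hs]. }
  assert (PG : forall x, 0 <= x -> 0 <= G x).
  { intros x [Hx | <-]; [apply Rlt_le, HGpos, Hx | lra]. }
  assert (Hsmall : forall u, admissible lam u0 w u -> forall s, s <= s0 -> / 2 * u0 s <= u s <= 3 / 2 * u0 s).
  { intros u [_ [_ Hu]] s Hs; specialize (Hu s); apply Rabs_le_between in Hu.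
    assert (w s <= / 4 * u0 s); [| lra].
    unfold w; specialize (HEle s Hs); rewrite Hsq in *.
    specialize (Hu0le s Hs); specialize (Hu0pos s); nra. }
  destruct (weighted_fixed_point lam (fun u => cascade k3 k5 (fun s => G (u s))) u0 w)
    as [a [Ha Hfix]].
  - intros s t Hst; unfold w, E.
    apply Rplus_le_compat; [| apply Rmult_le_compat_l; [lra |]]; apply exp_monotone; nra.
  - exact Hw0.
  - exact Tw.
  - exact Tu0.
  - intros s; apply Rlt_le, Hu0pos.
  - intros u Tu Pu; split.
    + apply cascade_decays; try lra; apply TG; assumption.
    + intros s; apply (cascade_nonneg lam); [lra | lra | apply TG; assumption |].
      intros v; apply PG, Pu.
  - intros s.
    (* the defect of [u0] is [cascade] of [G u0 - k u0], which is quadratic in [u0] before [s0] *)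
    assert (Heq : u0 s = cascade k3 k5 (fun s => k * exp (lam * s)) s).
    { rewrite (cascade_exp lam) by lra; rewrite Hg1; unfold u0; ring. }
    rewrite Heq.
    assert (Tk : decays lam (fun s => k * exp (lam * s))) by (apply decays_scal, decays_exp; lra).
    assert (TGu : decays lam (fun s => G (u0 s))) by (apply TG; [assumption | intros; apply Rlt_le, Hu0pos]).
    pose proof (cascade_minus lam k3 k5 (fun s => G (u0 s)) (fun s => k * exp (lam * s))
       ltac:(lra) ltac:(lra) ltac:(lra) TGu Tk) as Hm.
    apply (f_equal (fun h => h s)) in Hm; cbv beta in Hm; rewrite <- Hm; clear Hm.
    eapply Rle_trans.
    + apply (cascade_abs_le lam k3 k5 _ (2 * k) (2 * lam) (8 * (Lip + k) * kappa) mu);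
        [lra | lra | lra | lra | apply decays_minus; assumption |].
      intros v; fold (u0 v).
      replace (8 * (Lip + k) * kappa * exp (mu * v)) with (8 * (Lip + k) * E v) by (unfold E; ring).
      rewrite Hsq.
      specialize (Hu0pos v); specialize (HEpos v).
      destruct (Rle_lt_dec v s0) as [Hv | Hv].
      * specialize (HG2 (u0 v)); specialize (Hu0le v Hv).
        assert (0 <= 8 * (Lip + k) * E v) by (apply Rmult_le_pos; lra).
        specialize (HG2 ltac:(lra)); lra.
      * specialize (Hu0ge v ltac:(lra)); specialize (HEge v ltac:(lra)); rewrite Hsq in HEge.
        specialize (HLip (u0 v) 0 ltac:(lra) ltac:(lra)); rewrite HG0, !Rminus_0_r in HLip.
        rewrite (Rabs_pos_eq (u0 v)) in HLip by lra.
        eapply Rle_trans; [apply Rabs_triang |].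
        rewrite Rabs_Ropp, (Rabs_pos_eq (k * u0 v)) by (apply Rmult_le_pos; lra).
        assert (u0 v <= 8 * E v) by nra.
        assert ((Lip + k) * u0 v <= (Lip + k) * (8 * E v)) by (apply Rmult_le_compat_l; lra).
        assert (0 <= 2 * k * (u0 v * u0 v)) by (apply Rmult_le_pos; nra).
        lra.
    + unfold w, E.
      apply Rplus_le_compat.
      * rewrite <- (Rmult_1_l (exp (2 * lam * s))) at 2.
        apply Rmult_le_compat_r; [apply Rlt_le, exp_pos |]. nra.
      * apply Rmult_le_compat_r; [apply Rlt_le, exp_pos |].
        replace (8 * (Lip + k) * kappa * gain k3 k5 mu)
          with (kappa * (8 * (Lip + k) * gain k3 k5 mu)) by ring.
        rewrite <- (Rmult_1_r kappa) at 2; apply Rmult_le_compat_l; lra.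
  - intros u v D HD Au Av Huv s.
    pose proof Au as [Tu [Pu _]]; pose proof Av as [Tv [Pv _]].
    pose proof (cascade_minus lam k3 k5 (fun s => G (u s)) (fun s => G (v s))
       ltac:(lra) ltac:(lra) ltac:(lra) (TG u Tu Pu) (TG v Tv Pv)) as Hm.
    apply (f_equal (fun h => h s)) in Hm; cbv beta in Hm; rewrite <- Hm; clear Hm.
    eapply Rle_trans.
    + apply (cascade_abs_le lam k3 k5 _ (D * (2 * k)) (2 * lam) (D * (2 * Lip + 2 * k) * kappa) mu);
        [lra | lra | lra | lra | apply decays_minus; apply TG; assumption |].
      intros x.
      replace (D * (2 * Lip + 2 * k) * kappa * exp (mu * x)) with (D * (2 * Lip + 2 * k) * E x)
        by (unfold E; ring).
      specialize (Huv x); unfold w in Huv; specialize (HEpos x).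
      pose proof (exp_pos (2 * lam * x)) as Hx.
      assert (HDE : 0 <= D * E x) by (apply Rmult_le_pos; lra).
      assert (HDx : 0 <= D * exp (2 * lam * x)) by (apply Rmult_le_pos; lra).
      assert (HLDE : 0 <= Lip * (D * E x)) by (apply Rmult_le_pos; lra).
      (* before [s0] the term [E] is dominated by [exp (2 lam x)], after [s0] it dominates *)
      destruct (Rle_lt_dec x s0) as [Hxs | Hxs].
      * pose proof (Hsmall u Au x Hxs); pose proof (Hsmall v Av x Hxs).
        specialize (Hu0le x Hxs); specialize (Hu0pos x).
        eapply Rle_trans; [apply HLip2; lra |].
        apply Rmult_le_compat_l with (r := 2 * k) in Huv; [| lra].
        lra.
      * specialize (HEge x ltac:(lra)).
        eapply Rle_trans; [apply HLip; [apply Pu | apply Pv] |].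
        apply Rmult_le_compat_l with (r := Lip) in Huv; [| lra].
        assert (Lip * D * exp (2 * lam * x) <= Lip * D * E x)
          by (apply Rmult_le_compat_l; [apply Rmult_le_pos |]; lra).
        assert (0 <= k * (D * E x)) by (apply Rmult_le_pos; lra).
        assert (0 <= k * (D * exp (2 * lam * x))) by (apply Rmult_le_pos; lra).
        lra.
    + unfold w, E.
      rewrite (Rmult_plus_distr_l (D / 2)); apply Rplus_le_compat.
      * apply Rmult_le_compat_r; [apply Rlt_le, exp_pos |].
        rewrite Rmult_assoc; apply Rmult_le_compat_l; lra.
      * rewrite <- Rmult_assoc; apply Rmult_le_compat_r; [apply Rlt_le, exp_pos |].
        replace (D * (2 * Lip + 2 * k) * kappa * gain k3 k5 mu)
          with (D * kappa * ((2 * Lip + 2 * k) * gain k3 k5 mu)) by ring.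
        replace (D / 2 * kappa) with (D * kappa * / 2) by field.
        apply Rmult_le_compat_l; [apply Rmult_le_pos |]; lra.
  - pose proof (Hsmall a Ha) as Hbnd.
    destruct Ha as [Ta [Pa _]].
    set (c := fun s => k5 * resolvent k5 (fun v => G (a v)) s).
    set (b := fun s => k3 * resolvent k3 c s).
    pose proof (TG a Ta Pa) as TGa.
    assert (TJ5 : decays lam (resolvent k5 (fun v => G (a v)))) by (apply resolvent_decays; [lra | assumption]).
    assert (Tc : decays lam c) by (apply decays_scal; assumption).
    assert (TJ3 : decays lam (resolvent k3 c)) by (apply resolvent_decays; [lra | assumption]).
    assert (Tb : decays lam b) by (apply decays_scal; assumption).
    assert (Ha : resolvent 0 b = a) by (apply functional_extensionality; exact Hfix).
    assert (dJ5 : forall s, is_derive (resolvent k5 (fun v => G (a v))) s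
                    (k5 * resolvent k5 (fun v => G (a v)) s + G (a s))).
    { intros s; apply (resolvent_derive k5 (fun v => G (a v))), TGa. }
    assert (dJ3 : forall s, is_derive (resolvent k3 c) s (k3 * resolvent k3 c s + c s)).
    { intros s; apply resolvent_derive, Tc. }
    assert (Horb : unstable_orbit k3 k5 G a b c).
    { intros s; split; [| split].
      - rewrite <- Ha at 1.
        replace (b s) with (0 * resolvent 0 b s + b s) by ring; apply resolvent_derive, Tb.
      - exact (is_derive_scal (resolvent k3 c) s k3 _ (dJ3 s)).
      - exact (is_derive_scal (resolvent k5 (fun v => G (a v))) s k5 _ (dJ5 s)). }
    assert (Pc : forall s, 0 <= c s).
    { intros s; apply Rmult_le_pos; [lra |].
      apply (resolvent_nonneg lam); [lra | assumption | intros; apply PG, Pa]. }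
    assert (Pb : forall s, 0 <= b s).
    { intros s; apply Rmult_le_pos; [lra |].
      apply (resolvent_nonneg lam); [lra | assumption | assumption]. }
    (* strictness spreads from minus infinity, where [a >= u0 / 2], first to all of [a] and then
       to the variables that it drives *)
    assert (Sa : forall s, 0 < a s).
    { intros s; set (t := Rmin s s0).
      assert (t <= s0) by apply Rmin_r.
      apply Rlt_le_trans with (a t).
      - specialize (Hbnd t ltac:(assumption)); specialize (Hu0pos t); lra.
      - apply (le_of_derive_nonneg a b); [apply Rmin_l | | |].
        + intros v _; apply Horb.
        + intros v _; apply Ta.
        + intros v _; apply Pb. }
    assert (Sc : forall s, 0 < c s).
    { intros s; apply Rle_lt_trans with (c (s - 1)); [apply Pc |].
      apply (lt_of_derive_pos c (fun s => k5 * (c s + G (a s)))); [lra | | |].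
      - intros v _; apply Horb.
      - intros v _; apply Tc.
      - intros v _; specialize (Pc v); specialize (HGpos (a v) (Sa v)).
        apply Rmult_lt_0_compat; lra. }
    assert (Sb : forall s, 0 < b s).
    { intros s; apply Rle_lt_trans with (b (s - 1)); [apply Pb |].
      apply (lt_of_derive_pos b (fun s => k3 * (b s + c s))); [lra | | |].
      - intros v _; apply Horb.
      - intros v _; apply Tb.
      - intros v _; specialize (Pb v); specialize (Sc v).
        apply Rmult_lt_0_compat; lra. }
    (* exponential supersolutions from [G a <= 3 k u0]; the lower bound at the end comes from
       [G a >= k u0 / 4] *)
    assert (Hcle : forall s, s <= s0 -> c s <= 3 * k * k5 / (lam - k5) * u0 s).
    { intros s Hs.
      replace (3 * k * k5 / (lam - k5) * u0 s) with (k5 * (3 * k / (lam - k5) * exp (lam * s)))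
        by (unfold u0; field; lra).
      apply Rmult_le_compat_l; [lra |].
      apply (resolvent_le lam k5 _ (fun s => 3 * k / (lam - k5) * exp (lam * s))
               (fun s => lam * (3 * k / (lam - k5)) * exp (lam * s))); [lra | assumption | | |].
      - apply decays_scal, decays_exp; lra.
      - intros v; auto_derive; [exact I | ring].
      - intros v Hv; fold (u0 v).
        assert (HGv : G (a v) <= 3 * k * u0 v).
        { specialize (Hbnd v ltac:(lra)); specialize (Hu0le v ltac:(lra)); specialize (Hu0pos v).
          specialize (HLip2 (a v) 0 ltac:(lra) ltac:(lra)).
          rewrite HG0, !Rminus_0_r, (Rabs_pos_eq (a v)) in HLip2 by lra.
          pose proof (Rle_abs (G (a v))).
          assert (k * a v <= k * (3 / 2 * u0 v)) by (apply Rmult_le_compat_l; lra).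
          lra. }
        replace (lam * (3 * k / (lam - k5)) * u0 v)
          with (k5 * (3 * k / (lam - k5) * u0 v) + 3 * k * u0 v) by (field; lra).
        lra. }
    exists a, b, c, s0.
    split; [exact Horb |].
    split; [exact Ta | split; [exact Tb | split; [exact Tc |]]].
    split; [intros s; split; [apply Sa | split; [apply Sb | apply Sc]] |].
    split; [| split].
    + intros s Hs; specialize (Hbnd s Hs); specialize (Hu0le s Hs); lra.
    + apply Rle_trans with (3 * lam * u0 s0); [| rewrite Hu0s0; lra].
      replace (3 * lam * u0 s0) with (k3 * (3 * lam / k3 * exp (lam * s0))) by (unfold u0; field; lra).
      apply Rmult_le_compat_l; [lra |].
      apply (resolvent_le lam k3 _ (fun s => 3 * lam / k3 * exp (lam * s))
               (fun s => lam * (3 * lam / k3) * exp (lam * s))); [lra | assumption | | |].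
      * apply decays_scal, decays_exp; lra.
      * intros v; auto_derive; [exact I | ring].
      * intros v Hv; fold (u0 v).
        specialize (Hcle v Hv).
        replace (3 * k * k5 / (lam - k5)) with (3 * lam * (lam - k3) / k3) in Hcle.
        -- replace (lam * (3 * lam / k3) * u0 v)
             with (k3 * (3 * lam / k3 * u0 v) + 3 * lam * (lam - k3) / k3 * u0 v) by (field; lra).
           lra.
        -- apply Rmult_eq_reg_r with (k3 * (lam - k5)); [| apply Rgt_not_eq, Rmult_lt_0_compat; lra].
           transitivity (3 * (lam * (lam - k3) * (lam - k5))); [field; lra |].
           rewrite Hchar; field; lra.
    + replace (k * k5 / (lam - k5) / 32) with (k5 * (k / 4 / (lam - k5) * exp (lam * s0)))
        by (fold (u0 s0); rewrite Hu0s0; field; lra).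
      apply Rmult_le_compat_l; [lra |].
      apply (resolvent_ge lam k5 _ (fun s => k / 4 / (lam - k5) * exp (lam * s))
               (fun s => lam * (k / 4 / (lam - k5)) * exp (lam * s))); [lra | assumption | | |].
      * apply decays_scal, decays_exp; lra.
      * intros v; auto_derive; [exact I | ring].
      * intros v Hv; fold (u0 v).
        assert (HGv : k / 4 * u0 v <= G (a v)).
        { specialize (Hbnd v Hv); specialize (Hu0le v Hv); specialize (Hu0pos v).
          specialize (HG2 (a v) ltac:(lra)); apply Rabs_le_between in HG2.
          assert (2 * a v ^ 2 <= / 2 * a v) by nra.
          assert (k * (2 * a v ^ 2) <= k * (/ 2 * a v)) by (apply Rmult_le_compat_l; lra).
          assert (k * (/ 2 * u0 v) <= k * a v) by (apply Rmult_le_compat_l; lra).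
          lra. }
        replace (lam * (k / 4 / (lam - k5)) * u0 v)
          with (k5 * (k / 4 / (lam - k5) * u0 v) + k / 4 * u0 v) by (field; lra).
        lra.
Qed.

(** * Comparing solutions in the stable manifold *)

(** Replaces the unconstrained values at negative times, so that one-sided continuity at 0
    becomes continuity. *)
Definition clamp (f : R -> R) (t : R) : R := f (Rmax 0 t).

Lemma clamp_eq (f : R -> R) (t : R) : 0 <= t -> clamp f t = f t.
Proof. intros Ht; unfold clamp; rewrite Rmax_right by assumption; reflexivity. Qed.

Lemma clamp_derive (f d : R -> R) (t : R) :
  D_in f d halfline t -> 0 < t -> is_derive (clamp f) t (d t).
Proof.
  intros HD Ht.
  apply is_derive_Reals; intros e He.
  destruct (HD e He) as [al [Hal H]].
  assert (Hm : 0 < Rmin al t) by (apply Rmin_glb_lt; lra).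
  exists (mkposreal _ Hm); simpl; intros h Hh0 Hh.
  pose proof (Rmin_l al t); pose proof (Rmin_r al t).
  apply Rabs_lt_between in Hh as Hh'.
  rewrite !clamp_eq by lra.
  specialize (H (t + h)); simpl in H; unfold Rdist in H.
  replace (t + h - t) with h in H by ring.
  apply H; split; [| lra].
  split; [unfold halfline; lra | lra].
Qed.

Lemma clamp_continuous (f d : R -> R) :
  (forall t, 0 <= t -> D_in f d halfline t) -> forall t, continuous (clamp f) t.
Proof.
  intros HD t.
  apply filterlim_locally; intros e.
  pose proof (cont_deriv f d halfline (Rmax 0 t) (HD _ (Rmax_l 0 t))) as Hc.
  destruct (Hc e (cond_pos e)) as [al [Hal H]].
  exists (mkposreal al Hal); intros s Hs.
  unfold ball in *; simpl in *; unfold AbsRing_ball, abs, minus, plus, opp in *; simpl in *.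
  unfold clamp.
  destruct (Req_dec (Rmax 0 t) (Rmax 0 s)) as [-> | Hne].
  - rewrite Rplus_opp_r, Rabs_R0; apply cond_pos.
  - apply H; split; [split; [apply Rmax_l | exact Hne] |].
    eapply Rle_lt_trans; [| exact Hs].
    unfold Rdist, Rmax; destruct (Rle_dec 0 s), (Rle_dec 0 t);
      unfold Rabs; repeat destruct Rcase_abs; lra.
Qed.

Lemma derive_D_in (f d : R -> R) (A : R -> Prop) (t : R) :
  is_derive f t (d t) -> D_in f d A t.
Proof.
  intros Hf; apply is_derive_Reals in Hf.
  intros e He; destruct (Hf e He) as [de Hde].
  exists de; split; [apply cond_pos |].
  intros s [[_ Hne] Hs]; simpl in *; unfold Rdist in *.
  specialize (Hde (s - t) ltac:(lra) Hs).
  replace (t + (s - t)) with s in Hde by ring; exact Hde.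
Qed.

Lemma tends_to_iff (x y z : R -> R) (k : R) :
  tends_to x y z (equilibrium k) <->
  is_lim x p_infty k /\ is_lim y p_infty k /\ is_lim z p_infty k.
Proof.
  unfold tends_to, equilibrium; split.
  - intros H.
    pose proof (proj1 (filterlim_locally _ _) H) as HL.
    split; [| split]; apply (proj2 (filterlim_locally _ _)); intros e;
      generalize (HL e); apply filter_imp; intros t [[Hx Hy] Hz]; assumption.
  - intros [Hx [Hy Hz]].
    apply (proj2 (filterlim_locally _ _)); intros e.
    pose proof (proj1 (filterlim_locally _ _) Hx e) as Ex.
    pose proof (proj1 (filterlim_locally _ _) Hy e) as Ey.
    pose proof (proj1 (filterlim_locally _ _) Hz e) as Ez.
    generalize (filter_and _ _ Ex (filter_and _ _ Ey Ez)); apply filter_imp.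
    intros t [Ht1 [Ht2 Ht3]]; split; [split |]; assumption.
Qed.

(** The logarithmic mean, the coefficient [m] with [x - y = m (ln x - ln y)]. *)
Definition log_mean (x y : R) : R :=
  if Req_EM_T x y then x else (x - y) / (ln x - ln y).

Lemma log_mean_spec (x y : R) :
  0 < x -> 0 < y ->
  log_mean x y * (ln x - ln y) = x - y /\ Rmin x y <= log_mean x y <= Rmax x y.
Proof.
  intros Hx Hy; unfold log_mean; destruct (Req_EM_T x y) as [-> | Hne].
  - rewrite Rmin_left, Rmax_left by lra; lra.
  - assert (Hpos : 0 < Rmin y x) by (apply Rmin_glb_lt; assumption).
    destruct (MVT_gen ln y x (fun u => / u)) as [c [Hc He]].
    + intros u Hu; apply is_derive_ln; lra.
    + intros u Hu; apply continuity_pt_filterlim, (ex_derive_continuous ln).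
      eexists; apply is_derive_ln; lra.
    + assert (Hc0 : 0 < c) by lra.
      assert (Heq : (x - y) / (ln x - ln y) = c).
      { rewrite He; field; lra. }
      rewrite Heq; split.
      * rewrite He; field; lra.
      * rewrite (Rmin_comm x y), (Rmax_comm x y); assumption.
Qed.

Lemma is_lim_clamp (f : R -> R) (l : R) : is_lim f p_infty l -> is_lim (clamp f) p_infty l.
Proof.
  apply is_lim_ext_loc; exists 0; intros t Ht; symmetry; apply clamp_eq; lra.
Qed.

(** Since [x' <= k x], a solution with [x t <= 0] would keep [x <= 0] and not converge to [k]. *)
Lemma stable_x_positive (k k3 k5 : R) (x y z : R -> R) :
  0 < k -> forward_solution k k3 k5 x y z -> is_lim x p_infty k ->
  forall t, 0 <= t -> 0 < x t.
Proof.
  intros Hk Hs Hl t Ht.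
  destruct (Rle_lt_dec (x t) 0) as [Hx |]; [exfalso | assumption].
  destruct (is_lim_eventually_near x k k Hl Hk) as [T [HT0 HT]].
  set (s := Rmax t T + 1).
  assert (Hts : t < s) by (unfold s; pose proof (Rmax_l t T); lra).
  assert (HTs : T <= s) by (unfold s; pose proof (Rmax_r t T); lra).
  specialize (HT s HTs); apply Rabs_lt_between in HT.
  assert (Hcx : forall u, continuous (clamp x) u).
  { apply (clamp_continuous x (fun s => k * x s - x s * y s)); intros u Hu; apply Hs, Hu. }
  assert (Hg : - clamp x t * exp (k * (s - t)) <= - clamp x s).
  { apply (gronwall_lower k (fun u => - clamp x u) (fun u => - (k * x u - x u * y u)));
      [lra | | |].
    - intros u Hu.
      apply (is_derive_opp (clamp x)), (clamp_derive x (fun s => k * x s - x s * y s));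
        [apply Hs; lra | lra].
    - intros u _; apply (continuous_opp (clamp x)), Hcx.
    - intros u Hu; rewrite !clamp_eq by lra.
      destruct (Hs u ltac:(lra)) as [[Px [Py Pz]] _].
      pose proof (Rmult_le_pos _ _ Px Py); lra. }
  rewrite !clamp_eq in Hg by lra.
  pose proof (exp_pos (k * (s - t))).
  nra.
Qed.

(** Two solutions in the stable manifold are ordered in the order of the cone, or coincide:
    this is what makes the stable manifold a curve. *)
Lemma stable_solutions_ordered (k k3 k5 : R) (x1 y1 z1 x2 y2 z2 : R -> R) :
  0 < k3 -> 0 < k5 -> k3 + k5 < k ->
  forward_solution k k3 k5 x1 y1 z1 -> tends_to x1 y1 z1 (equilibrium k) ->
  forward_solution k k3 k5 x2 y2 z2 -> tends_to x2 y2 z2 (equilibrium k) ->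
  (forall t, 0 <= t -> x1 t = x2 t /\ y1 t = y2 t /\ z1 t = z2 t) \/
  (forall t, 0 <= t -> x2 t < x1 t /\ y2 t < y1 t /\ z1 t < z2 t) \/
  (forall t, 0 <= t -> x1 t < x2 t /\ y1 t < y2 t /\ z2 t < z1 t).
Proof.
  intros H3 H5 Hk S1 L1 S2 L2.
  apply tends_to_iff in L1, L2.
  destruct L1 as [Lx1 [Ly1 Lz1]]; destruct L2 as [Lx2 [Ly2 Lz2]].
  destruct (dominant_rate_exists k k3 k5 H3 H5 Hk) as [lam Hlam].
  assert (P1 : forall t, 0 < clamp x1 t).
  { intros t; apply (stable_x_positive k k3 k5 x1 y1 z1); try assumption; [lra | apply Rmax_l]. }
  assert (P2 : forall t, 0 < clamp x2 t).
  { intros t; apply (stable_x_positive k k3 k5 x2 y2 z2); try assumption; [lra | apply Rmax_l]. }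
  assert (Cx1 : forall u, continuous (clamp x1) u).
  { eapply clamp_continuous; intros u Hu; apply S1, Hu. }
  assert (Cy1 : forall u, continuous (clamp y1) u).
  { eapply clamp_continuous; intros u Hu; apply S1, Hu. }
  assert (Cz1 : forall u, continuous (clamp z1) u).
  { eapply clamp_continuous; intros u Hu; apply S1, Hu. }
  assert (Cx2 : forall u, continuous (clamp x2) u).
  { eapply clamp_continuous; intros u Hu; apply S2, Hu. }
  assert (Cy2 : forall u, continuous (clamp y2) u).
  { eapply clamp_continuous; intros u Hu; apply S2, Hu. }
  assert (Cz2 : forall u, continuous (clamp z2) u).
  { eapply clamp_continuous; intros u Hu; apply S2, Hu. }
  assert (Cln : forall (f : R -> R) (u : R), 0 < f u -> continuous f u -> continuous (fun t => ln (f t)) u).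
  { intros f u Hp Hc; apply (continuous_comp f ln); [exact Hc |].
    apply (ex_derive_continuous ln); eexists; apply is_derive_ln, Hp. }
  set (a := fun t => ln (clamp x1 t) - ln (clamp x2 t)).
  set (b := fun t => clamp y1 t - clamp y2 t).
  set (c := fun t => clamp z2 t - clamp z1 t).
  set (m := fun t => log_mean (clamp x1 t) (clamp x2 t)).
  assert (Hm : forall t, m t * a t = clamp x1 t - clamp x2 t /\
                Rmin (clamp x1 t) (clamp x2 t) <= m t <= Rmax (clamp x1 t) (clamp x2 t)).
  { intros t; apply log_mean_spec; [apply P1 | apply P2]. }
  assert (Hsys : cone_system k3 k5 m a b c).
  { split.
    - intros t; split; [| split].
      + apply (continuous_minus (fun t => ln (clamp x1 t)) (fun t => ln (clamp x2 t)));
          apply Cln; auto.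
      + apply (continuous_minus (clamp y1) (clamp y2)); auto.
      + apply (continuous_minus (clamp z2) (clamp z1)); auto.
    - intros t Ht.
      destruct (S1 t ltac:(lra)) as [_ [dx1 [dy1 dz1]]].
      destruct (S2 t ltac:(lra)) as [_ [dx2 [dy2 dz2]]].
      apply clamp_derive in dx1, dy1, dz1, dx2, dy2, dz2; try assumption.
      cbv beta in *.
      rewrite (proj1 (Hm t)); unfold a, b, c.
      specialize (P1 t); specialize (P2 t).
      split; [| split].
      + auto_derive.
        * split; [eexists; exact dx1 | split; [exact P1 |]].
          split; [eexists; exact dx2 | split; [exact P2 | exact I]].
        * subst_derive dx1; subst_derive dx2.
          rewrite !clamp_eq in * by lra; field; lra.
      + auto_derive.
        * split; [eexists; exact dy1 | split; [eexists; exact dy2 | exact I]].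
        * subst_derive dy1; subst_derive dy2; rewrite !clamp_eq by lra; ring.
      + auto_derive.
        * split; [eexists; exact dz2 | split; [eexists; exact dz1 | exact I]].
        * subst_derive dz1; subst_derive dz2; rewrite !clamp_eq by lra; ring. }
  destruct (vanishing_solution_signed k k3 k5 lam m a b c) as [H | [H | H]]; try assumption.
  - intros t _; destruct (Hm t) as [_ [Hm1 _]].
    eapply Rlt_le_trans; [| exact Hm1]; apply Rmin_glb_lt; auto.
  - intros T; destruct (Rle_lt_dec 0 T) as [HT | HT].
    + destruct (continuity_ab_maj (clamp x1) 0 T HT) as [M1 [HM1 _]].
      { intros u _; apply continuity_pt_filterlim, Cx1. }
      destruct (continuity_ab_maj (clamp x2) 0 T HT) as [M2 [HM2 _]].
      { intros u _; apply continuity_pt_filterlim, Cx2. }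
      exists (Rmax (clamp x1 M1) (clamp x2 M2)); intros t Ht.
      eapply Rle_trans; [apply Hm |].
      apply Rmax_lub; [eapply Rle_trans; [apply HM1, Ht | apply Rmax_l]
                      |eapply Rle_trans; [apply HM2, Ht | apply Rmax_r]].
    + exists 0; intros t Ht; lra.
  - apply is_lim_clamp in Lx1, Lx2.
    apply is_lim_spec; intros e.
    destruct (is_lim_eventually_near _ _ e Lx1 (cond_pos e)) as [T1 [_ HT1]].
    destruct (is_lim_eventually_near _ _ e Lx2 (cond_pos e)) as [T2 [_ HT2]].
    exists (Rmax T1 T2); intros t Ht.
    pose proof (Rmax_l T1 T2); pose proof (Rmax_r T1 T2).
    specialize (HT1 t ltac:(lra)); specialize (HT2 t ltac:(lra)).
    apply Rabs_lt_between in HT1, HT2.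
    destruct (Hm t) as [_ [Hm1 Hm2]].
    apply Rabs_lt_between; split.
    + apply Rlt_le_trans with (Rmin (clamp x1 t) (clamp x2 t) - k); [| lra].
      cut (k - e < Rmin (clamp x1 t) (clamp x2 t)); [lra |]; apply Rmin_glb_lt; lra.
    + apply Rle_lt_trans with (Rmax (clamp x1 t) (clamp x2 t) - k); [lra |].
      cut (Rmax (clamp x1 t) (clamp x2 t) < k + e); [lra |]; apply Rmax_lub_lt; lra.
  - apply is_lim_clamp in Lx1, Lx2; unfold a.
    assert (Hln : forall f : R -> R, is_lim f p_infty k -> is_lim (fun t => ln (f t)) p_infty (ln k)).
    { intros f Hf; apply (filterlim_comp _ _ _ f ln _ (locally k) (locally (ln k)) Hf).
      apply (ex_derive_continuous ln); eexists; apply is_derive_ln; lra. }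
    replace 0 with (ln k - ln k) by ring.
    apply (is_lim_minus' _ _ _ (ln k) (ln k)); apply Hln; assumption.
  - unfold b; replace 0 with (k - k) by ring.
    apply (is_lim_minus' _ _ _ k k); apply is_lim_clamp; assumption.
  - unfold c; replace 0 with (k - k) by ring.
    apply (is_lim_minus' _ _ _ k k); apply is_lim_clamp; assumption.
  - left; intros t Ht; destruct (H t Ht) as [Ha [Hb Hc]].
    destruct (Hm t) as [Hmt _]; rewrite Ha, Rmult_0_r in Hmt.
    unfold b, c in *; rewrite !clamp_eq in * by assumption; lra.
  - right; left; intros t Ht; destruct (H t Ht) as [Ha [Hb Hc]].
    unfold a, b, c in *.
    assert (clamp x2 t < clamp x1 t) by (apply ln_lt_inv; auto; lra).
    rewrite !clamp_eq in * by assumption; lra.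
  - right; right; intros t Ht; destruct (H t Ht) as [Ha [Hb Hc]].
    unfold a, b, c in *.
    assert (clamp x1 t < clamp x2 t) by (apply ln_lt_inv; auto; lra).
    rewrite !clamp_eq in * by assumption; lra.
Qed.

(** * The two branches of the stable manifold *)

(** An unstable orbit of the reversed system, read forward in time from the point with
    parameter [S].  The sign [sg] is [1] when [x > k] and [-1] when [x < k]. *)
Definition branch_x (k sg : R) (a : R -> R) (S t : R) : R := k * exp (sg * a (S - t)).
Definition branch_y (k sg : R) (b : R -> R) (S t : R) : R := k + sg * b (S - t).
Definition branch_z (k sg : R) (c : R -> R) (S t : R) : R := k - sg * c (S - t).

(** The hypothesis on [G] says that [sg * a] obeys the true nonlinearity up to time [S]; beyond
    it [G] may have been truncated. *)
Lemma branch_solution (k k3 k5 sg : R) (G a b c : R -> R) (S : R) :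
  0 < k -> unstable_orbit k3 k5 G a b c ->
  (forall s, s <= S -> sg * G (a s) = k * (exp (sg * a s) - 1)) ->
  (forall s, s <= S -> 0 <= k + sg * b s /\ 0 <= k - sg * c s) ->
  forward_solution k k3 k5 (branch_x k sg a S) (branch_y k sg b S) (branch_z k sg c S).
Proof.
  intros Hk Horb HG Hpos t Ht.
  destruct (Hpos (S - t) ltac:(lra)) as [Py Pz].
  destruct (Horb (S - t)) as [da [db dc]].
  specialize (HG (S - t) ltac:(lra)).
  split; [| split; [| split]].
  - split; [| split; assumption].
    apply Rlt_le, Rmult_lt_0_compat; [assumption | apply exp_pos].
  - apply derive_D_in; unfold branch_x, branch_y; auto_derive.
    + eexists; exact da.
    + change (S + - t) with (S - t); subst_derive da; ring.
  - apply derive_D_in; unfold branch_y, branch_z; auto_derive.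
    + eexists; exact db.
    + change (S + - t) with (S - t); subst_derive db; ring.
  - apply derive_D_in; unfold branch_x, branch_z; auto_derive.
    + eexists; exact dc.
    + change (S + - t) with (S - t); subst_derive dc.
      replace (k5 * (k * exp (sg * a (S - t)) - (k - sg * c (S - t))))
        with (k5 * (k * (exp (sg * a (S - t)) - 1) + sg * c (S - t))) by ring.
      rewrite <- HG; ring.
Qed.

Lemma decays_small (lam : R) (f : R -> R) (e : R) :
  0 < lam -> decays lam f -> 0 < e -> exists u, forall s, s <= u -> Rabs (f s) < e.
Proof.
  intros Hl [_ [C HC]] He.
  destruct (exp_small lam C e 0 Hl He) as [u [_ [Hu0 Hu]]].
  exists u; intros s Hs.
  eapply Rle_lt_trans; [apply HC; lra |].
  eapply Rle_lt_trans; [| exact Hu].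
  assert (0 <= C).
  { specialize (HC 0 (Rle_refl 0)); rewrite Rmult_0_r, exp_0 in HC.
    pose proof (Rabs_pos (f 0)); lra. }
  apply Rmult_le_compat_l; [assumption |]; apply exp_monotone; nra.
Qed.

Lemma decays_reversed_lim (lam : R) (f : R -> R) (S : R) :
  0 < lam -> decays lam f -> is_lim (fun t => f (S - t)) p_infty 0.
Proof.
  intros Hl Hf; apply is_lim_spec; intros e.
  destruct (decays_small lam f e Hl Hf (cond_pos e)) as [u Hu].
  exists (S - u); intros t Ht; rewrite Rminus_0_r; apply Hu; lra.
Qed.

Lemma branch_tends (lam k sg : R) (a b c : R -> R) (S : R) :
  0 < lam -> decays lam a -> decays lam b -> decays lam c ->
  tends_to (branch_x k sg a S) (branch_y k sg b S) (branch_z k sg c S) (equilibrium k).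
Proof.
  intros Hl Ta Tb Tc.
  apply tends_to_iff; split; [| split].
  - pose proof (is_lim_0_scal _ sg (decays_reversed_lim lam a S Hl Ta)) as L.
    assert (Le : is_lim (fun t => exp (sg * a (S - t))) p_infty (exp 0)).
    { apply (filterlim_comp _ _ _ (fun t => sg * a (S - t)) exp _ (locally 0) (locally (exp 0)) L).
      apply (ex_derive_continuous exp); eexists; apply is_derive_exp. }
    pose proof (is_lim_scal_l _ k _ _ Le) as L'; simpl in L'; rewrite exp_0, Rmult_1_r in L'.
    exact L'.
  - pose proof (is_lim_0_scal _ sg (decays_reversed_lim lam b S Hl Tb)) as L.
    pose proof (is_lim_plus' _ _ _ k 0 (is_lim_const k p_infty) L) as L'.
    rewrite Rplus_0_r in L'; exact L'.
  - pose proof (is_lim_0_scal _ sg (decays_reversed_lim lam c S Hl Tc)) as L.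
    pose proof (is_lim_minus' _ _ _ k 0 (is_lim_const k p_infty) L) as L'.
    rewrite Rminus_0_r in L'; exact L'.
Qed.

Lemma decays_attains (lam : R) (f : R -> R) (v s1 : R) :
  0 < lam -> decays lam f -> 0 < v <= f s1 -> exists s, s <= s1 /\ f s = v.
Proof.
  intros Hl Hf [Hv Hs1].
  destruct (Req_dec v (f s1)) as [-> | Hne]; [exists s1; split; [lra | reflexivity] |].
  destruct (decays_small lam f v Hl Hf Hv) as [u Hu].
  set (s2 := Rmin u (s1 - 1)).
  assert (Hs2 : s2 < s1) by (unfold s2; pose proof (Rmin_r u (s1 - 1)); lra).
  assert (Hf2 : f s2 < v).
  { eapply Rle_lt_trans; [apply Rle_abs | apply Hu, Rmin_l]. }
  destruct (IVT (fun s => f s - v) s2 s1) as [s [Hs Hz]]; [| assumption | lra | lra |].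
  - intros u'; apply continuity_pt_minus.
    + apply continuity_pt_filterlim, Hf.
    + apply continuity_pt_const; intros ? ?; reflexivity.
  - exists s; lra.
Qed.

Lemma exponential_growth (kap f0 v s0 : R) (f df : R -> R) :
  0 < kap -> 0 < f0 -> 0 < v ->
  (forall s, is_derive f s (df s)) -> (forall s, kap * f s <= df s) ->
  f0 <= f s0 -> v <= f (s0 + v / (f0 * kap)).
Proof.
  intros Hk Hf0 Hv Hd Hle H0.
  set (T := v / (f0 * kap)).
  assert (HT : 0 < T) by (apply Rdiv_lt_0_compat; [| apply Rmult_lt_0_compat]; assumption).
  assert (Hg : f s0 * exp (kap * (s0 + T - s0)) <= f (s0 + T)).
  { apply (gronwall_lower kap f df); [lra | | |]; intros u _;
      [apply Hd | apply (derive_continuous f u _ (Hd u)) | apply Hle]. }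
  replace (s0 + T - s0) with T in Hg by ring.
  pose proof (exp_ineq1_le (kap * T)).
  assert (HkT : f0 * (kap * T) = v) by (unfold T; field; lra).
  assert (0 < kap * T) by (apply Rmult_lt_0_compat; assumption).
  assert (f0 * exp (kap * T) <= f s0 * exp (kap * T))
    by (apply Rmult_le_compat_r; [apply Rlt_le, exp_pos | assumption]).
  assert (f0 * (1 + kap * T) <= f0 * exp (kap * T)) by (apply Rmult_le_compat_l; lra).
  lra.
Qed.

(** From [1 + x <= exp x] at the difference of the arguments. *)
Lemma exp_lipschitz (M x y : R) :
  x <= M -> y <= M -> Rabs (exp x - exp y) <= exp M * Rabs (x - y).
Proof.
  assert (Hw : forall x y, y <= x -> x <= M -> Rabs (exp x - exp y) <= exp M * Rabs (x - y)).
  { clear x y; intros x y Hyx Hx.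
    pose proof (exp_monotone y x Hyx) as He.
    rewrite !Rabs_pos_eq by lra.
    apply Rle_trans with (exp x * (x - y)).
    - pose proof (exp_ineq1_le (y - x)) as Hi.
      replace (exp y) with (exp x * exp (y - x)) by (rewrite <- exp_plus; f_equal; ring).
      pose proof (exp_pos x). nra.
    - apply Rmult_le_compat_r; [lra | apply exp_monotone, Hx]. }
  intros Hx Hy; destruct (Rle_lt_dec y x) as [H | H].
  - apply Hw; assumption.
  - rewrite (Rabs_minus_sym (exp x)), (Rabs_minus_sym x); apply Hw; [lra | assumption].
Qed.

Lemma orbit_increasing (k3 k5 : R) (G a b c : R -> R) :
  0 < k3 -> 0 < k5 -> unstable_orbit k3 k5 G a b c ->
  (forall s, positive_at a b c s) -> (forall x, 0 < x -> 0 < G x) ->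
  forall s t, s < t -> a s < a t /\ b s < b t /\ c s < c t.
Proof.
  intros H3 H5 Horb Hpos HG s t Hst.
  assert (Hd : forall u, is_derive a u (b u)) by (intros; apply Horb).
  assert (Hd' : forall u, is_derive b u (k3 * (b u + c u))) by (intros; apply Horb).
  assert (Hd'' : forall u, is_derive c u (k5 * (c u + G (a u)))) by (intros; apply Horb).
  split; [| split].
  - apply (lt_of_derive_pos a b); try assumption; intros u _;
      [apply Hd | exact (derive_continuous a u _ (Hd u)) | apply Hpos].
  - apply (lt_of_derive_pos b (fun s => k3 * (b s + c s))); try assumption; intros u _;
      [apply Hd' | exact (derive_continuous b u _ (Hd' u)) |].
    destruct (Hpos u) as [? [? ?]]; apply Rmult_lt_0_compat; lra.
  - apply (lt_of_derive_pos c (fun s => k5 * (c s + G (a s)))); try assumption; intros u _;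
      [apply Hd'' | exact (derive_continuous c u _ (Hd'' u)) |].
    destruct (Hpos u) as [? [? ?]]; specialize (HG (a u) ltac:(assumption)).
    apply Rmult_lt_0_compat; lra.
Qed.

(** Every starting parameter up to [S] gives a solution: those before [S] are the time shifts
    of the one starting at [S]. *)
Definition branch_data (k k3 k5 sg : R) (a b c : R -> R) (S : R) : Prop :=
  exists lam, 0 < lam /\ decays lam a /\ decays lam b /\ decays lam c /\
  (forall s, positive_at a b c s) /\
  (forall s t, s < t -> a s < a t /\ b s < b t /\ c s < c t) /\
  (forall S', S' <= S ->
     forward_solution k k3 k5 (branch_x k sg a S') (branch_y k sg b S') (branch_z k sg c S')).

(** Here [G] is globally [k]-Lipschitz on the positive axis, and [b' >= k3 b] makes [b] reach
    [k], that is [y] reach 0. *)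
Lemma upper_branch_exists (k k3 k5 : R) :
  0 < k3 -> 0 < k5 -> k3 + k5 < k ->
  exists a b c S, branch_data k k3 k5 (-1) a b c S /\ b S = k.
Proof.
  intros H3 H5 Hk.
  destruct (dominant_rate_exists k k3 k5 H3 H5 Hk) as [lam Hlam].
  set (G := fun x => k * (1 - exp (- x))).
  assert (HGpos : forall x, 0 < x -> 0 < G x).
  { intros x Hx; apply Rmult_lt_0_compat; [lra |].
    assert (exp (- x) < exp 0) by (apply exp_increasing; lra). rewrite exp_0 in *; lra. }
  assert (HGlip : forall x y, 0 <= x -> 0 <= y -> Rabs (G x - G y) <= k * Rabs (x - y)).
  { intros x y Hx Hy; unfold G.
    replace (k * (1 - exp (- x)) - k * (1 - exp (- y))) with (k * (exp (- y) - exp (- x))) by ring.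
    rewrite Rabs_mult, (Rabs_pos_eq k) by lra.
    apply Rmult_le_compat_l; [lra |].
    pose proof (exp_lipschitz 0 (- y) (- x) ltac:(lra) ltac:(lra)) as He.
    rewrite exp_0, Rmult_1_l in He; replace (- y - - x) with (x - y) in He by ring; exact He. }
  destruct (unstable_orbit_exists k k3 k5 lam k G) as [a [b [c [s0 [Horb [Ta [Tb [Tc [Hpos _]]]]]]]]];
    try assumption; try lra.
  - intros x; apply continuity_pt_filterlim; unfold G; reg.
  - intros x y Hx Hy; eapply Rle_trans; [apply HGlip; lra |].
    pose proof (Rabs_pos (x - y)); nra.
  - intros x Hx; unfold G.
    pose proof (exp_ineq1_le (- x)); pose proof (exp_ineq1_le x); pose proof (exp_pos (- x)).
    assert (Hee : exp (- x) * exp x = 1) by (rewrite <- exp_plus, Rplus_opp_l; apply exp_0).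
    assert (exp (- x) * (1 + x) <= 1) by (rewrite <- Hee; apply Rmult_le_compat_l; lra).
    assert (x * (1 - x) <= x * exp (- x)) by (apply Rmult_le_compat_l; lra).
    replace (k * (1 - exp (- x)) - k * x) with (- (k * (exp (- x) - (1 - x)))) by ring.
    rewrite Rabs_Ropp, Rabs_mult, !Rabs_pos_eq by lra.
    rewrite (Rmult_comm 2 k), Rmult_assoc; apply Rmult_le_compat_l; [lra |].
    pose proof (pow2_ge_0 x); nra.
  - pose proof Hlam as [Hlam' _].
    set (s1 := 0 + k / (b 0 * k3)).
    assert (Hb1 : k <= b s1).
    { apply (exponential_growth k3 (b 0) k 0 b (fun s => k3 * (b s + c s))); try lra.
      - apply Hpos.
      - intros s; apply Horb.
      - intros s; destruct (Hpos s) as [_ [_ ?]]; apply Rmult_le_compat_l; lra. }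
    destruct (decays_attains lam b k s1) as [S [_ HS]]; [lra | assumption | lra |].
    pose proof (orbit_increasing k3 k5 G a b c H3 H5 Horb Hpos HGpos) as Hinc.
    exists a, b, c, S; split; [| assumption].
    exists lam; repeat (split; [first [assumption | lra] |]).
    intros S' HS'; apply (branch_solution k k3 k5 (-1) G); [lra | assumption | |].
    + intros s _; unfold G; replace (-1 * a s) with (- a s) by ring; ring.
    + intros s Hs; destruct (Hpos s) as [_ [_ ?]].
      assert (b s <= k); [| lra].
      rewrite <- HS; destruct (Req_dec s S) as [-> | ?]; [lra |].
      apply Rlt_le, Hinc; lra.
Qed.

(** The exponential is cut off at a level [A] that the orbit does not exceed while [c <= k]:
    from [c s0 >= c0] and [c' >= k5 c] the value [k] is attained by time [s0 + T]; until
    then [b' <= k3 (b + k)] bounds [b] by [B], and [a' = b] bounds [a] by [A]. *)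
Lemma lower_branch_exists (k k3 k5 : R) :
  0 < k3 -> 0 < k5 -> k3 + k5 < k ->
  exists a b c S, branch_data k k3 k5 1 a b c S /\ c S = k.
Proof.
  intros H3 H5 Hk.
  destruct (dominant_rate_exists k k3 k5 H3 H5 Hk) as [lam Hlam].
  pose proof Hlam as [Hlam' _].
  set (c0 := k * k5 / (lam - k5) / 32).
  assert (Hc0 : 0 < c0).
  { unfold c0; repeat apply Rdiv_lt_0_compat; try lra; apply Rmult_lt_0_compat; lra. }
  set (T := k / (c0 * k5)).
  assert (HT : 0 < T) by (apply Rdiv_lt_0_compat; [lra | apply Rmult_lt_0_compat; lra]).
  set (B := (lam + k) * exp (k3 * T)).
  assert (HB : 0 < B) by (apply Rmult_lt_0_compat; [lra | apply exp_pos]).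
  set (A := / 2 + B * T).
  assert (HA : / 2 < A) by (unfold A; pose proof (Rmult_lt_0_compat B T HB HT); lra).
  set (G := fun x => k * (exp (Rmin x A) - 1)).
  assert (HGpos : forall x, 0 < x -> 0 < G x).
  { intros x Hx; apply Rmult_lt_0_compat; [lra |].
    assert (exp 0 < exp (Rmin x A)) by (apply exp_increasing, Rmin_glb_lt; lra).
    rewrite exp_0 in *; lra. }
  assert (Hmin : forall x y, Rabs (Rmin x A - Rmin y A) <= Rabs (x - y)).
  { intros x y; unfold Rmin; destruct (Rle_dec x A), (Rle_dec y A);
      unfold Rabs; repeat destruct Rcase_abs; lra. }
  assert (Hhalf : exp (/ 2) <= 2).
  { pose proof exp_le_3. pose proof (exp_pos (/ 2)).
    replace 1 with (/ 2 + / 2) in H by field; rewrite exp_plus in H; nra. }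
  destruct (unstable_orbit_exists k k3 k5 lam (k * exp A) G)
    as [a [b [c [s0 [Horb [Ta [Tb [Tc [Hpos [Has [Hb0 Hc0s]]]]]]]]]]];
    try assumption; try lra.
  - apply Rmult_le_pos; [lra | apply Rlt_le, exp_pos].
  - intros x; apply (continuous_scal_r k (fun x => exp (Rmin x A) - 1)).
    apply (continuous_minus (fun x => exp (Rmin x A)) (fun _ => 1)); [| apply continuous_const].
    apply (continuous_comp (fun x => Rmin x A) exp).
    + apply filterlim_locally; intros e; exists e; intros y Hy.
      eapply Rle_lt_trans; [apply Hmin | exact Hy].
    + apply (ex_derive_continuous exp); eexists; apply is_derive_exp.
  - intros x y _ _; unfold G.
    replace (k * (exp (Rmin x A) - 1) - k * (exp (Rmin y A) - 1))
      with (k * (exp (Rmin x A) - exp (Rmin y A))) by ring.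
    rewrite Rabs_mult, (Rabs_pos_eq k), Rmult_assoc by lra.
    apply Rmult_le_compat_l; [lra |].
    eapply Rle_trans; [apply (exp_lipschitz A); apply Rmin_r |].
    apply Rmult_le_compat_l; [apply Rlt_le, exp_pos | apply Hmin].
  - intros x y Hx Hy; unfold G; rewrite !Rmin_left by lra.
    replace (k * (exp x - 1) - k * (exp y - 1)) with (k * (exp x - exp y)) by ring.
    rewrite Rabs_mult, (Rabs_pos_eq k), (Rmult_comm 2 k), Rmult_assoc by lra.
    apply Rmult_le_compat_l; [lra |].
    eapply Rle_trans; [apply (exp_lipschitz (/ 2)); lra |].
    apply Rmult_le_compat_r; [apply Rabs_pos | assumption].
  - intros x Hx; unfold G; rewrite Rmin_left by lra.
    pose proof (exp_ineq1_le (- x)); pose proof (exp_ineq1_le x); pose proof (exp_pos x).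
    assert (Hee : exp (- x) * exp x = 1) by (rewrite <- exp_plus, Rplus_opp_l; apply exp_0).
    assert (exp x <= 2) by (eapply Rle_trans; [apply exp_monotone | exact Hhalf]; lra).
    assert ((1 - x) * exp x <= 1) by (rewrite <- Hee; apply Rmult_le_compat_r; lra).
    assert (x * exp x <= x * (1 + 2 * x)).
    { apply Rmult_le_compat_l; [lra |].
      assert (x * exp x <= x * 2) by (apply Rmult_le_compat_l; lra). lra. }
    replace (k * (exp x - 1) - k * x) with (k * (exp x - 1 - x)) by ring.
    rewrite Rabs_mult, !Rabs_pos_eq by lra.
    rewrite (Rmult_comm 2 k), Rmult_assoc; apply Rmult_le_compat_l; [lra |].
    replace (x ^ 2) with (x * x) by ring; lra.
  - pose proof (orbit_increasing k3 k5 G a b c H3 H5 Horb Hpos HGpos) as Hinc.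
    assert (Hc1 : k <= c (s0 + T)).
    { apply (exponential_growth k5 c0 k s0 c (fun s => k5 * (c s + G (a s)))); try lra.
      - intros s; apply Horb.
      - intros s; destruct (Hpos s) as [? _]; specialize (HGpos (a s) ltac:(assumption)).
        apply Rmult_le_compat_l; lra.
      - exact Hc0s. }
    destruct (decays_attains lam c k (s0 + T)) as [S [HST HS]]; [lra | assumption | lra |].
    assert (Hck : forall s, s <= S -> c s <= k).
    { intros s Hs; rewrite <- HS; destruct (Req_dec s S) as [-> | ?]; [lra |].
      apply Rlt_le, Hinc; lra. }
    assert (Hbs : forall s, s0 <= s <= S -> b s <= B).
    { intros s Hs.
      assert (Hm : - (b s0 + k) * exp (k3 * (s - s0)) <= - (b s + k)).
      { apply (gronwall_lower k3 (fun u => - (b u + k)) (fun u => - (k3 * (b u + c u))));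
          [lra | | |].
        - intros u _; destruct (Horb u) as [_ [du _]]; auto_derive; [eexists; exact du |].
          subst_derive du; ring.
        - intros u _; pose proof (proj1 Tb u) as Cu.
          apply continuity_pt_filterlim; apply continuity_pt_filterlim in Cu; reg; assumption.
        - intros u Hu; specialize (Hck u ltac:(lra)).
          assert (k3 * c u <= k3 * k) by (apply Rmult_le_compat_l; lra); lra. }
      assert (exp (k3 * (s - s0)) <= exp (k3 * T)).
      { apply exp_monotone, Rmult_le_compat_l; lra. }
      pose proof (exp_pos (k3 * (s - s0))).
      destruct (Hpos s0) as [_ [? _]].
      assert ((b s0 + k) * exp (k3 * (s - s0)) <= (lam + k) * exp (k3 * T))
        by (apply Rmult_le_compat; lra).
      unfold B; lra. }
    assert (HaA : forall s, s <= S -> a s <= A).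
    { intros s Hs; destruct (Rle_lt_dec s s0) as [Hss | Hss].
      - specialize (Has s Hss); lra.
      - assert (Hm : B * s0 - a s0 <= B * s - a s).
        { apply (le_of_derive_nonneg (fun u => B * u - a u) (fun u => B - b u)); [lra | | |].
          - intros u _; destruct (Horb u) as [du _]; auto_derive; [eexists; exact du |].
            subst_derive du; ring.
          - intros u _; pose proof (proj1 Ta u) as Cu.
            apply continuity_pt_filterlim; apply continuity_pt_filterlim in Cu; reg; assumption.
          - intros u Hu; specialize (Hbs u ltac:(lra)); lra. }
        specialize (Has s0 (Rle_refl s0)).
        assert (B * (s - s0) <= B * T) by (apply Rmult_le_compat_l; lra).
        unfold A; lra. }
    exists a, b, c, S; split; [| assumption].
    exists lam; repeat (split; [first [assumption | lra] |]).
    intros S' HS'; apply (branch_solution k k3 k5 1 G); [lra | assumption | |].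
    + intros s Hs; unfold G; rewrite Rmin_left by (apply HaA; lra); rewrite !Rmult_1_l; reflexivity.
    + intros s Hs; destruct (Hpos s) as [_ [? _]]; specialize (Hck s ltac:(lra)); lra.
Qed.

Lemma equilibrium_solution (k k3 k5 : R) :
  0 < k -> forward_solution k k3 k5 (fun _ => k) (fun _ => k) (fun _ => k).
Proof.
  intros Hk t _; split; [simpl; lra |].
  split; [| split]; apply derive_D_in; auto_derive; trivial; ring.
Qed.

Lemma equilibrium_tends (k : R) : tends_to (fun _ => k) (fun _ => k) (fun _ => k) (equilibrium k).
Proof. apply tends_to_iff; split; [| split]; apply is_lim_const. Qed.

Lemma branch_in_stable_manifold (k k3 k5 sg : R) (a b c : R -> R) (S : R) (P : R3) :
  branch_data k k3 k5 sg a b c S ->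
  trajectory (branch_x k sg a S) (branch_y k sg b S) (branch_z k sg c S) P ->
  stable_manifold k k3 k5 P.
Proof.
  intros [lam [Hl [Ta [Tb [Tc [_ [_ Hsol]]]]]]] [t [Ht ->]].
  assert (Hs : forward_solution k k3 k5 (branch_x k sg a (S - t)) (branch_y k sg b (S - t))
                 (branch_z k sg c (S - t))) by (apply Hsol; lra).
  split; [exact (proj1 (Hsol S (Rle_refl S) t Ht)) |].
  exists (branch_x k sg a (S - t)), (branch_y k sg b (S - t)), (branch_z k sg c (S - t)).
  split; [assumption | split].
  - unfold branch_x, branch_y, branch_z; rewrite Rminus_0_r; reflexivity.
  - apply (branch_tends lam); assumption.
Qed.

(** A solution in the stable manifold that shares its initial [y] or its initial [z] with a
    point of the branch is not strictly ordered with respect to it, hence coincides with it. *)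
Lemma same_point_on_branch (k k3 k5 sg : R) (a b c x y z : R -> R) (S S' : R) :
  0 < k3 -> 0 < k5 -> k3 + k5 < k ->
  branch_data k k3 k5 sg a b c S -> S' <= S ->
  forward_solution k k3 k5 x y z -> tends_to x y z (equilibrium k) ->
  y 0 = k + sg * b S' \/ z 0 = k - sg * c S' ->
  trajectory (branch_x k sg a S) (branch_y k sg b S) (branch_z k sg c S) (x 0, y 0, z 0).
Proof.
  intros H3 H5 Hk [lam [Hl [Ta [Tb [Tc [_ [_ Hsol]]]]]]] HS' Hs Ht Hcoord.
  pose proof (branch_tends lam k sg a b c S' Hl Ta Tb Tc) as Ht'.
  exists (S - S'); split; [lra |].
  unfold branch_x, branch_y, branch_z.
  replace (S - (S - S')) with S' by ring.
  destruct (stable_solutions_ordered k k3 k5 x y z _ _ _ H3 H5 Hk Hs Ht (Hsol S' HS') Ht')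
    as [H | [H | H]];
    specialize (H 0 (Rle_refl 0)); unfold branch_x, branch_y, branch_z in H;
    rewrite Rminus_0_r in H.
  - destruct H as [-> [-> ->]]; reflexivity.
  - exfalso; lra.
  - exfalso; lra.
Qed.

Theorem proposition1p2 :
  forall k k3 k5 : R, 0 < k3 -> 0 < k5 -> k3 + k5 < k ->
  exists xu yu zu xl yl zl : R -> R,
    forward_solution k k3 k5 xu yu zu /\
    forward_solution k k3 k5 xl yl zl /\
    (forall P : R3,
       stable_manifold k k3 k5 P <->
       P = equilibrium k \/ trajectory xu yu zu P \/ trajectory xl yl zl P) /\
    (yu 0 = 0 /\ 0 < xu 0 < k /\ k < zu 0 /\
     tends_to xu yu zu (equilibrium k) /\
     strictly_increasing_on halfline xu /\
     strictly_increasing_on halfline yu /\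
     strictly_decreasing_on halfline zu /\
     (forall x y z : R, trajectory xu yu zu (x, y, z) ->
        0 <= x <= k /\ 0 <= y <= k /\ k <= z)) /\
    (zl 0 = 0 /\ k < xl 0 /\ k < yl 0 /\
     tends_to xl yl zl (equilibrium k) /\
     strictly_decreasing_on halfline xl /\
     strictly_decreasing_on halfline yl /\
     strictly_increasing_on halfline zl /\
     (forall x y z : R, trajectory xl yl zl (x, y, z) ->
        k <= x /\ k <= y /\ 0 <= z <= k)).
Proof.
  intros k k3 k5 H3 H5 Hk.
  destruct (upper_branch_exists k k3 k5 H3 H5 Hk) as [au [bu [cu [Su [Du HSu]]]]].
  destruct (lower_branch_exists k k3 k5 H3 H5 Hk) as [al [bl [cl [Sl [Dl HSl]]]]].
  pose proof Du as [lu [Hlu [Tau [Tbu [Tcu [Pu [Iu Fu]]]]]]].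
  pose proof Dl as [ll [Hll [Tal [Tbl [Tcl [Pl [Il Fl]]]]]]].
  assert (Xu : forall s, 0 < k * exp (-1 * au s) < k).
  { intros s; destruct (Pu s) as [Ha _].
    pose proof (exp_pos (-1 * au s)).
    assert (exp (-1 * au s) < exp 0) by (apply exp_increasing; lra); rewrite exp_0 in *.
    split; [apply Rmult_lt_0_compat |]; nra. }
  assert (Xl : forall s, k < k * exp (1 * al s)).
  { intros s; destruct (Pl s) as [Ha _].
    assert (exp 0 < exp (1 * al s)) by (apply exp_increasing; lra); rewrite exp_0 in *; nra. }
  exists (branch_x k (-1) au Su), (branch_y k (-1) bu Su), (branch_z k (-1) cu Su),
    (branch_x k 1 al Sl), (branch_y k 1 bl Sl), (branch_z k 1 cl Sl).
  split; [apply Fu, Rle_refl |].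
  split; [apply Fl, Rle_refl |].
  split; [| split].
  - intros P; split.
    + intros [HP [x [y [z [Hs [HP0 Ht]]]]]]; subst P; destruct HP as [Hx0 [Hy0 Hz0]].
      destruct (stable_solutions_ordered k k3 k5 x y z _ _ _ H3 H5 Hk Hs Ht
                  (equilibrium_solution k k3 k5 ltac:(lra)) (equilibrium_tends k))
        as [H | [H | H]]; specialize (H 0 (Rle_refl 0)); destruct H as [Hx [Hy Hz]].
      * left; unfold equilibrium; congruence.
      * right; right.
        (* the branch passes through every height [z] in [[0, k)] *)
        destruct (decays_attains ll cl (k - z 0) Sl) as [S' [HS' HcS']]; [assumption | assumption | lra |].
        apply (same_point_on_branch k k3 k5 1 al bl cl x y z Sl S'); try assumption.
        right; lra.
      * right; left.
        destruct (decays_attains lu bu (k - y 0) Su) as [S' [HS' HbS']]; [assumption | assumption | lra |].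
        apply (same_point_on_branch k k3 k5 (-1) au bu cu x y z Su S'); try assumption.
        left; lra.
    + intros [-> | [HP | HP]].
      * split; [simpl; lra |].
        exists (fun _ => k), (fun _ => k), (fun _ => k).
        split; [apply equilibrium_solution; lra | split; [reflexivity | apply equilibrium_tends]].
      * apply (branch_in_stable_manifold k k3 k5 (-1) au bu cu Su); assumption.
      * apply (branch_in_stable_manifold k k3 k5 1 al bl cl Sl); assumption.
  - assert (Hcmp : forall s t, 0 <= s -> s < t ->
              au (Su - t) < au (Su - s) /\ bu (Su - t) < bu (Su - s) /\ cu (Su - t) < cu (Su - s))
      by (intros; apply Iu; lra).
    split; [unfold branch_y; rewrite Rminus_0_r; lra |].
    split; [apply Xu |].
    split; [unfold branch_z; destruct (Pu (Su - 0)) as [_ [_ ?]]; lra |].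
    split; [apply (branch_tends lu); assumption |].
    split; [| split; [| split]].
    + intros s t Hs _ Hst; destruct (Hcmp s t Hs Hst) as [? _].
      apply Rmult_lt_compat_l; [lra | apply exp_increasing; lra].
    + intros s t Hs _ Hst; destruct (Hcmp s t Hs Hst) as [_ [? _]]; unfold branch_y; lra.
    + intros s t Hs _ Hst; destruct (Hcmp s t Hs Hst) as [_ [_ ?]]; unfold branch_z; lra.
    + intros x y z [t [Ht Heq]]; injection Heq as -> -> ->.
      destruct (Fu Su (Rle_refl Su) t Ht) as [[Qx [Qy Qz]] _].
      destruct (Pu (Su - t)) as [_ [Hb Hc]].
      specialize (Xu (Su - t)).
      unfold branch_x, branch_y, branch_z in *; lra.
  - assert (Hcmp : forall s t, 0 <= s -> s < t ->
              al (Sl - t) < al (Sl - s) /\ bl (Sl - t) < bl (Sl - s) /\ cl (Sl - t) < cl (Sl - s))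
      by (intros; apply Il; lra).
    split; [unfold branch_z; rewrite Rminus_0_r; lra |].
    split; [apply Xl |].
    split; [unfold branch_y; destruct (Pl (Sl - 0)) as [_ [? _]]; lra |].
    split; [apply (branch_tends ll); assumption |].
    split; [| split; [| split]].
    + intros s t Hs _ Hst; destruct (Hcmp s t Hs Hst) as [? _].
      apply Rmult_lt_compat_l; [lra | apply exp_increasing; lra].
    + intros s t Hs _ Hst; destruct (Hcmp s t Hs Hst) as [_ [? _]]; unfold branch_y; lra.
    + intros s t Hs _ Hst; destruct (Hcmp s t Hs Hst) as [_ [_ ?]]; unfold branch_z; lra.
    + intros x y z [t [Ht Heq]]; injection Heq as -> -> ->.
      destruct (Fl Sl (Rle_refl Sl) t Ht) as [[Qx [Qy Qz]] _].
      destruct (Pl (Sl - t)) as [_ [Hb Hc]].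
      specialize (Xl (Sl - t)).
      unfold branch_x, branch_y, branch_z in *; lra.
Qed.
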